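(* Let $p$ and $d$ be positive integers, let $\mathbf{\Sigma} \in \mathcal{S}_p^+$ and let $\alpha \geq 0$. Let $\mathbf{W}$ be a $p \times d$ random matrix whose columns are independent and identically distributed, each following the $\mathcal{N}(0,\mathbf{\Sigma})$ distribution on $\mathbb{R}^p$, and let $\mathbf{y} \sim \mathcal{N}(0,\alpha\mathbf{I}_d)$ be a Gaussian vector in $\mathbb{R}^d$ independent of $\mathbf{W}$. Then $$\mathbf{W}\mathbf{y} \sim \mathrm{GAL}_p(2\alpha\mathbf{\Sigma}, 0, d/2).$$ Moreover, if $u$ is a standard Gamma variable with shape parameter $d/2$ (that is, $u \sim \mathrm{Gamma}(d/2,1)$) and if $\mathbf{x} \sim \mathcal{N}(0,2\alpha\mathbf{\Sigma})$ is a Gaussian vector in $\mathbb{R}^p$ independent of $u$, then $\mathbf{W}\mathbf{y}$ and $\sqrt{u}\,\mathbf{x}$ have the same distribution.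
   Context: $\mathcal{S}_p^+$ denotes the cone of (symmetric) positive semidefinite real matrices of size $p \times p$; $\mathcal{N}(0,\mathbf{\Sigma})$ is the centered Gaussian distribution with covariance matrix $\mathbf{\Sigma}$ (possibly degenerate); $\mathbf{I}_d$ is the $d \times d$ identity matrix. The Gamma distribution $\mathrm{Gamma}(a,b)$ is in the shape-rate parametrization (shape $a$, rate $b$). For $s>0$, $\boldsymbol{\mu} \in \mathbb{R}^p$ and $\mathbf{\Sigma} \in \mathcal{S}_p^+$, a random variable $\mathbf{z} \in \mathbb{R}^p$ is said to have a multivariate generalized asymmetric Laplace distribution with parameters $s, \boldsymbol{\mu}, \mathbf{\Sigma}$, denoted $\mathbf{z} \sim \mathrm{GAL}_p(\mathbf{\Sigma},\boldsymbol{\mu},s)$, if its characteristic function is $$\forall \mathbf{u} \in \mathbb{R}^p, \quad \mathbb{E}\left[e^{i\mathbf{u}^T\mathbf{z}}\right] = \left(\frac{1}{1+\frac{1}{2}\mathbf{u}^T\mathbf{\Sigma}\mathbf{u} - i\boldsymbol{\mu}^T\mathbf{u}}\right)^s,$$ where the complex power is taken with the principal branch (the base has positive real part). *)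

(* Defs.v *)
From HB Require Import structures.
From mathcomp Require Import all_boot all_order all_algebra.
From mathcomp Require Import all_classical all_reals all_analysis.
From mathcomp Require Import complex.
Set Implicit Arguments.
Unset Strict Implicit.
Unset Printing Implicit Defensive.
Import Order.TTheory GRing.Theory Num.Theory.
Import numFieldNormedType.Exports.
Local Open Scope classical_set_scope.
Local Open Scope ring_scope.

(* Vectors of R^p are columns 'cV[R]_p. The measurable sets of 'M[R]_(m, n)
   are its Borel sets, generated by the open sets of the library topology. *)
HB.instance Definition _ (R : realType) (m n : nat) :=
  @isMeasurable.Build (sigma_display (@open 'M[R]_(m, n))) 'M[R]_(m, n)
    <<s @open 'M[R]_(m, n) >> (@sigma_algebra0 _ setT open)
    (@sigma_algebraC _ open) (@sigma_algebra_bigcup _ setT open).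

Section complex_functions.
Context {R : realType}.
Implicit Types z : R[i].
Local Open Scope complex_scope.

Definition cexp z : R[i] :=
  (expR (complex.Re z) * cos (complex.Im z)) +i*
  (expR (complex.Re z) * sin (complex.Im z)).

(* Principal argument, in ]-pi, pi] (for z != 0). *)
Definition carg z : R :=
  let t := acos (complex.Re z / ComplexField.Normc.normc z) in
  if 0 <= complex.Im z then t else - t.

Definition clog z : R[i] := ln (ComplexField.Normc.normc z) +i* carg z.

(* Principal branch of z ^ s, for z != 0. *)
Definition cpow z (s : R) : R[i] := cexp (s%:C * clog z).

End complex_functions.

Section linear_algebra.
Context {R : realType} {p : nat}.

Definition dotv (u v : 'cV[R]_p) : R := (u^T *m v) 0 0.

Definition quadform (A : 'M[R]_p) (u : 'cV[R]_p) : R := (u^T *m A *m u) 0 0.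

Definition psdmx (A : 'M[R]_p) : Prop :=
  A^T = A /\ forall u : 'cV[R]_p, 0 <= quadform A u.

End linear_algebra.

Section independence_and_law.
Context {d : measure_display} {T : measurableType d} {R : realType}.
Variable P : probability T R.

Definition independent2 {d1 d2 : measure_display} {T1 : measurableType d1}
    {T2 : measurableType d2} (X : T -> T1) (Y : T -> T2) : Prop :=
  forall (A : set T1) (B : set T2), measurable A -> measurable B ->
    (P (X @^-1` A `&` Y @^-1` B) = P (X @^-1` A) * P (Y @^-1` B))%E.

Definition mutually_independent {d1 : measure_display}
    {T1 : measurableType d1} {I : finType} (X : I -> T -> T1) : Prop :=
  forall (J : {set I}) (A : I -> set T1),
    (forall i, i \in J -> measurable (A i)) ->
    (P (\bigcap_(i in [set` J]) (X i @^-1` A i)) =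
     \prod_(i in J) P (X i @^-1` A i))%E.

(* The two random variables may live on different probability spaces. *)
Definition same_distribution {d' : measure_display} {T' : measurableType d'}
    (P' : probability T' R) {d1 : measure_display} {T1 : measurableType d1}
    (X : T -> T1) (Y : T' -> T1) : Prop :=
  [/\ measurable_fun setT X, measurable_fun setT Y &
      forall A : set T1, measurable A -> P (X @^-1` A) = P' (Y @^-1` A)].

End independence_and_law.

Section gaussian.
Context {R : realType}.

(* N(0, v) on the line, v being the variance; [normal_prob] takes the standard
   deviation and is not a Dirac mass when it is 0. *)
Definition centered_normal (v : R) : set R -> \bar R :=
  if v == 0 then dirac (0 : R) else normal_prob 0 (Num.sqrt v).

(* X ~ N(0, Sigma), Sigma possibly singular: every linear form u^T X is
   N(0, u^T Sigma u). *)
Definition gaussian {d : measure_display} {T : measurableType d}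
    (P : probability T R) {p : nat} (Sigma : 'M[R]_p) (X : T -> 'cV[R]_p) :
    Prop :=
  measurable_fun setT X /\
  forall (u : 'cV[R]_p) (A : set R), measurable A ->
    P ((fun t => dotv u (X t)) @^-1` A) = centered_normal (quadform Sigma u) A.

End gaussian.

Section gamma.
Context {R : realType}.

Definition Gamma_fun (a : R) : R :=
  Rintegral (@lebesgue_measure R) `]0, +oo[%classic
    (fun x => x `^ (a - 1) * expR (- x)).

(* shape a, rate b *)
Definition gamma_pdf (a b x : R) : R :=
  if 0 < x then b `^ a / Gamma_fun a * x `^ (a - 1) * expR (- (b * x)) else 0.

Definition gamma_distributed {d : measure_display} {T : measurableType d}
    (P : probability T R) (a b : R) (U : T -> R) : Prop :=
  measurable_fun setT U /\
  forall A : set R, measurable A ->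
    P (U @^-1` A) = (\int[@lebesgue_measure R]_(x in A) (gamma_pdf a b x)%:E)%E.

End gamma.

Section generalized_asymmetric_laplace.
Context {R : realType} {d : measure_display} {T : measurableType d}.
Variable P : probability T R.
Local Open Scope complex_scope.

(* Meaningful when the real and imaginary parts of Z are integrable. *)
Definition Cexpectation (Z : T -> R[i]) : R[i] :=
  fine ('E_P[fun t => complex.Re (Z t)])%E +i*
  fine ('E_P[fun t => complex.Im (Z t)])%E.

Definition char_fun {p : nat} (Z : T -> 'cV[R]_p) (u : 'cV[R]_p) : R[i] :=
  Cexpectation (fun t => cexp (0 +i* dotv u (Z t))).

(* Z ~ GAL_p(Sigma, mu, s), for s > 0 and Sigma positive semidefinite *)
Definition GAL {p : nat} (Sigma : 'M[R]_p) (mu : 'cV[R]_p) (s : R)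
    (Z : T -> 'cV[R]_p) : Prop :=
  measurable_fun setT Z /\
  forall u : 'cV[R]_p,
    char_fun Z u =
    cpow (1 / (1 + (quadform Sigma u / 2)%:C - (0 +i* dotv mu u))) s.

End generalized_asymmetric_laplace.

(* Main.v *)
(** Conditionally on [W], the scalar [u^T W y] is centered normal with variance
    [alpha |W^T u|^2], so its characteristic function is the product over the
    columns [w_j] of the expectations of [exp (- alpha (u^T w_j)^2 / 2)], that is
    [(1 + alpha u^T Sigma u)^(- d / 2)]. Conditionally on the Gamma variable the
    characteristic function of [sqrt u x] is [exp (- alpha u v^T Sigma v)] at [v],
    and the Laplace transform of the Gamma law gives the same value.

    Equality of the laws follows without Fourier inversion. Trigonometric
    polynomials form an algebra on which both laws agree; iterating the cubic
    [(3 s - s^3) / 2] on [sin ((x_k - b_k) / n)], multiplying over [k] and letting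
    [n] grow, they converge boundedly to the indicators of the orthants
    [{x | forall k, b_k < x_k}], a pi-system generating the Borel sets. *)
Require Import Defs.
From HB Require Import structures.
From mathcomp Require Import all_boot all_order all_algebra.
From mathcomp Require Import all_classical all_reals all_analysis.
From mathcomp Require Import measurable_realfun complex.
From mathcomp Require Import ring lra.
Import Order.TTheory GRing.Theory Num.Theory.
Import numFieldNormedType.Exports.
Set Implicit Arguments.
Unset Strict Implicit.
Unset Printing Implicit Defensive.
Local Open Scope classical_set_scope.
Local Open Scope ring_scope.

(** * Transfer of integrals between weighted measures *)

Section weighted_integrals.
Context d1 d2 d3 {T1 : measurableType d1} {T2 : measurableType d2}
  {S : measurableType d3} {R : realType}.
Variables (mu1 : {measure set T1 -> \bar R}) (mu2 : {measure set T2 -> \bar R}).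
Variables (X1 : T1 -> S) (X2 : T2 -> S) (g1 : T1 -> R) (g2 : T2 -> R).
Hypotheses (mX1 : measurable_fun setT X1) (mX2 : measurable_fun setT X2).
Hypotheses (mg1 : measurable_fun setT g1) (mg2 : measurable_fun setT g2).
Hypotheses (g1_ge0 : forall x, 0 <= g1 x) (g2_ge0 : forall x, 0 <= g2 x).

Import HBNNSimple.

(** A simple function has finitely many values, so the integral splits over its level sets. *)
Local Lemma integral_nnsfun_weighted d (T : measurableType d)
    (mu : {measure set T -> \bar R}) (X : T -> S) (g : T -> R)
    (mX : measurable_fun setT X) (mg : measurable_fun setT g)
    (g_ge0 : forall x, 0 <= g x) (h : {nnsfun S >-> R}) :
  (\int[mu]_x (h (X x) * g x)%:E =
   \sum_(y \in range h) y%:E * \int[mu]_(x in X @^-1` (h @^-1` [set y])) (g x)%:E)%E.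
Proof.
have mA y : measurable (X @^-1` (h @^-1` [set y])).
  by rewrite -[X @^-1` _]setTI; apply: mX => //; exact: measurable_funPTI.
under eq_integral => x _.
  rewrite (fimfunE h) mulr_fsuml -fsumEFin//.
  over.
have ind_ge0 y x : 0 <= y * \1_(h @^-1` [set y]) (X x).
  rewrite indicE; have [|] := boolP (_ \in _); rewrite ?mulr0// mulr1.
  by rewrite inE /= => <-; exact: fun_ge0.
rewrite ge0_integral_fsum//; last 2 first.
- move=> y; apply/measurable_EFinP; apply: measurable_funM => //.
  apply: measurable_funM => //.
  by apply: (measurableT_comp _ mX); exact: measurable_indic.
- by move=> y x _; rewrite lee_fin mulr_ge0.
apply: eq_fsbigr => y /[!inE] -[s _ hs]; rewrite [in RHS]integral_mkcond.
rewrite -ge0_integralZl//; first last.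
- by rewrite lee_fin -hs.
- by move=> x _; rewrite erestrict_ge0// => ? _; rewrite lee_fin.
- apply/(measurable_restrictT _ _).1 => //.
  by apply/measurable_EFinP; exact: measurable_funTS.
apply: eq_integral => x _; rewrite patchE indicE.
have -> : (x \in X @^-1` (h @^-1` [set y])) = (X x \in h @^-1` [set y]).
  by apply/idP/idP; rewrite !inE.
by case: ifPn => _ /=; [rewrite mulr1 EFinM|rewrite mulr0 mul0r mule0].
Qed.

(** The hypothesis says that [g1 mu1] and [g2 mu2] have the same image measure on [S]. Level sets
    give the claim for simple functions, and monotone convergence extends it to [f]. It serves as
    the change of variables for densities, for rescaling, and for independence. *)
Lemma eq_integral_weighted :
  (forall A, measurable A ->
    \int[mu1]_(x in X1 @^-1` A) (g1 x)%:E =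
    \int[mu2]_(x in X2 @^-1` A) (g2 x)%:E)%E ->
  forall f : S -> R, measurable_fun setT f -> (forall s, 0 <= f s) ->
  (\int[mu1]_x (f (X1 x) * g1 x)%:E = \int[mu2]_x (f (X2 x) * g2 x)%:E)%E.
Proof.
move=> g12 f mf f0.
have mEf : measurable_fun setT (EFin \o f) by exact/measurable_EFinP.
pose h := nnsfun_approx measurableT mEf.
have approx d (T : measurableType d) (mu : {measure set T -> \bar R})
    (X : T -> S) (g : T -> R) : measurable_fun setT X -> measurable_fun setT g ->
    (forall x, 0 <= g x) ->
    (\int[mu]_x (f (X x) * g x)%:E =
     limn (fun n => \int[mu]_x (h n (X x) * g x)%:E))%E.
  move=> mX mg g0; rewrite -monotone_convergence//.
  - apply: eq_integral => x _; apply/esym/cvg_lim => //.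
    rewrite EFinM; under eq_fun do rewrite EFinM.
    apply: cvgeZr => //; apply: (@cvg_nnsfun_approx _ _ _ _ _ _ mEf) => // s _.
    by rewrite lee_fin.
  - move=> n; apply/measurable_EFinP; apply: measurable_funM => //.
    exact: measurableT_comp.
  - by move=> n x _; rewrite lee_fin mulr_ge0.
  - move=> x _ a b ab; rewrite lee_fin ler_wpM2r//.
    exact/lefP/nd_nnsfun_approx.
rewrite !approx//; congr (limn _); apply/funext => n.
rewrite !integral_nnsfun_weighted//; apply: eq_fsbigr => y _.
by rewrite g12//; exact: measurable_funPTI.
Qed.

End weighted_integrals.

(** * Borel sets of matrices and the orthants that generate them *)

Section borel_matrices.
Context {R : realType}.

Lemma measurable_mx_coord (m n : nat) (i : 'I_m) (j : 'I_n) :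
  measurable_fun setT (fun M : 'M[R]_(m, n) => M i j).
Proof.
apply: (measurability _ (RGenOpens.measurableE R)) => _ [_ [a [b ->]] <-].
rewrite setTI; apply: sub_sigma_algebra.
apply: open_comp; last exact: interval_open.
by move=> M _; apply: coord_continuous.
Qed.

(* Every open set is the union of the rational balls it contains, hence of
   countably many boxes. *)
Lemma sub_borel_mx (m n : nat) (S : set (set 'M[R]_(m, n))) :
  sigma_algebra setT S ->
  (forall i j (B : set R), measurable B -> S [set M | B (M i j)]) ->
  measurable `<=` S.
Proof.
move=> sS coordS; apply: smallest_sub => // U openU.
pose box (c : 'M[rat]_(m, n) * nat) : set 'M[R]_(m, n) :=
  [set M | forall i j, ball (ratr (c.1 i j) : R) c.2.+1%:R^-1 (M i j)].
(* The same matrices, measured by the sigma-algebra that [S] generates; since [S] is already one,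
   [smallest_sub] returns to [S] at the end. *)
pose GT := g_sigma_algebraType S.
have mbox c : measurable (box c : set GT).
  rewrite (_ : box c = \bigcap_(ij in [set: 'I_m * 'I_n])
      [set M | ball (ratr (c.1 ij.1 ij.2) : R) c.2.+1%:R^-1 (M ij.1 ij.2)]).
    apply: fin_bigcap_measurable => // -[i j] _ /=.
    apply: sub_sigma_algebra; exact: (coordS i j _ (measurable_ball _ _)).
  apply/seteqP; split => [M cM [i j] _|M cM i j]; first exact: cM.
  exact: (cM (i, j)).
(* Boxes that leave [U] are replaced by the empty set, so that the union runs over a whole countable
   type. *)
have -> : U = \bigcup_c (if `[< box c `<=` U >] then box c else set0).
  apply/seteqP; split => [M UM|M [c _ /=]]; last first.
    by case: asboolP => // cU cM; exact: cU.
  have : nbhs M U by exact: (open_nbhs_nbhs (conj openU UM)).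
  move=> /nbhs_ballP[e /= e0 MeU].
  (* Half of [e], because a point of the box is compared with [M] through the rational centre. *)
  have [N] : exists N : nat, 0 + N.+1%:R^-1 < e / 2.
    by apply: ltr_add_invr; rewrite divr_gt0.
  rewrite add0r => Ne.
  have N0 : 0 < N.+1%:R^-1 :> R by rewrite invr_gt0.
  have rat_near i j : exists q : rat, ball (M i j) N.+1%:R^-1 (ratr q : R).
    have [|q] := @rat_in_itvoo R (M i j - N.+1%:R^-1) (M i j + N.+1%:R^-1).
      by rewrite ltrD2l gt0_cp.
    by move=> qM; exists q; rewrite ball_itv.
  have [c cM] : exists c : 'M[rat]_(m, n), forall i j,
      ball (M i j) N.+1%:R^-1 (ratr (c i j) : R).
    (* The default 0 is never taken: [rat_near] makes each of these sets nonempty. *)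
    exists (\matrix_(i, j) xget 0 [set q : rat | ball (M i j) N.+1%:R^-1 (ratr q : R)]).
    move=> i j; rewrite mxE; case: xgetP => [q -> //|/(_ _)].
    by have [q qM] := rat_near i j => /(_ q).
  exists (c, N) => //; case: asboolP => [_ i j|[]].
    exact/ball_sym/cM.
  move=> M' cM'; apply: MeU; split => // i j.
  rewrite [e]splitr; apply: (@ball_triangle _ _ (ratr (c i j) : R)).
    exact: le_ball (ltW Ne) _ (cM i j).
  exact: le_ball (ltW Ne) _ (cM' i j).
have : measurable (\bigcup_c (if `[< box c `<=` U >] then box c else set0) : set GT).
  apply: countable_bigcupT_measurable => [|c]; first exact: countableP.
  by case: asboolP.
exact: smallest_sub.
Qed.

(** The sets with measurable preimage under [f] form a sigma-algebra, so [sub_borel_mx] reduces the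
    question to coordinates. *)
Lemma measurable_fun_mx d (T : measurableType d) (m n : nat)
    (f : T -> 'M[R]_(m, n)) :
  (forall i j, measurable_fun setT (fun t => f t i j)) -> measurable_fun setT f.
Proof.
move=> mf _ A mA; rewrite setTI; move: A mA.
apply: (@sub_borel_mx m n [set A | measurable (f @^-1` A)]) => [|i j B mB].
  split => /= [|A mA|F mF].
  - by rewrite preimage_set0.
  - by rewrite setTD preimage_setC; exact: measurableC.
  - by rewrite preimage_bigcup; exact: bigcupT_measurable.
by have := mf i j measurableT B mB; rewrite setTI.
Qed.

Lemma measurable_mulmx d (T : measurableType d) (m n k : nat)
    (f : T -> 'M[R]_(m, n)) (g : T -> 'M[R]_(n, k)) :
  measurable_fun setT f -> measurable_fun setT g ->
  measurable_fun setT (fun t => f t *m g t).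
Proof.
move=> mf mg; apply: measurable_fun_mx => i j.
under eq_fun do rewrite mxE.
apply: measurable_sum => l; apply: measurable_funM.
- exact: (measurableT_comp (measurable_mx_coord i l) mf).
- exact: (measurableT_comp (measurable_mx_coord l j) mg).
Qed.

Lemma measurable_dotv d (T : measurableType d) (p : nat)
    (f g : T -> 'cV[R]_p) :
  measurable_fun setT f -> measurable_fun setT g ->
  measurable_fun setT (fun t => dotv (f t) (g t)).
Proof.
move=> mf mg; rewrite /dotv; apply: (measurableT_comp (measurable_mx_coord 0 0)).
apply: measurable_mulmx => //; apply: measurable_fun_mx => i j.
under eq_fun do rewrite mxE.
exact: (measurableT_comp (measurable_mx_coord j i) mf).
Qed.

Lemma measurable_dotvr (p : nat) (u : 'cV[R]_p) :
  measurable_fun setT (dotv u).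
Proof. exact: (measurable_dotv (measurable_cst u) (@measurable_id _ _ setT)). Qed.

Lemma measurable_orthant (p : nat) (b : 'cV[R]_p) :
  measurable [set x : 'cV[R]_p | forall k, b k 0 < x k 0].
Proof.
have mcoord k (r : R) : measurable [set x : 'cV[R]_p | r < x k 0].
  rewrite (_ : [set _ | _] = (fun x : 'cV[R]_p => x k 0) @^-1` `]r, +oo[).
    rewrite -[_ @^-1` _]setTI.
    exact: (measurable_mx_coord k (0 : 'I_1) measurableT (measurable_itv _)).
  by apply/seteqP; split => x /=; rewrite in_itv/= andbT.
rewrite (_ : [set x : 'cV[R]_p | forall k, b k 0 < x k 0] =
    \bigcap_(k in [set: 'I_p]) [set x | b k 0 < x k 0]).
  by apply: fin_bigcap_measurable => // k _; exact: mcoord.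
by apply/seteqP; split => x bx k => [_|]; exact: bx.
Qed.

(** Orthants are stable under intersection (take the coordinatewise maximum of the corners), they
    generate the Borel sets, and countably many of them, of finite measure, cover the space. *)
Lemma eq_measure_orthants (p : nat) (m1 m2 : {measure set 'cV[R]_p -> \bar R}) :
  (0 < p)%N -> (m1 setT < +oo)%E ->
  (forall b : 'cV[R]_p, m1 [set x | forall k, b k 0 < x k 0] =
                        m2 [set x | forall k, b k 0 < x k 0]) ->
  forall A, measurable A -> m1 A = m2 A.
Proof.
move=> p0 m1oo m12.
pose orth (b : 'cV[R]_p) : set 'cV[R]_p := [set x | forall k, b k 0 < x k 0].
pose G := range orth.
have coverG : \bigcup_i orth (const_mx (- i%:R)) = setT.
  apply/seteqP; split => // x _.
  (* An integer above the sum of the [|x k 0|] bounds every [- x k 0] at once. *)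
  exists (Num.truncn (\sum_k `|x k 0|)).+1 => // k; rewrite mxE ltrNl.
  apply: (@le_lt_trans _ _ (\sum_k `|x k 0|)); last exact: truncnS_gt.
  rewrite (bigD1 k)//= (le_trans (ler_norm (- x k 0)))// normrN lerDl.
  exact: sumr_ge0.
have sG : measurable `<=` <<s G >>.
  apply: sub_borel_mx; first exact: smallest_sigma_algebra.
  move=> i j B mB; pose GT := g_sigma_algebraType G.
  have mx : measurable_fun setT (fun x : GT => (x : 'cV[R]_p) i j).
    apply: (measurability _ (RGenOInfty.measurableE R)) => _ [_ [a ->] <-].
    (* A half-space is the union of the orthants with corner [a] in direction [i] and [- n] in the
       other directions. *)
    rewrite setTI (_ : _ @^-1` _ = \bigcup_n
      orth (\col_k (if k == i then a else - n%:R))).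
      apply: bigcupT_measurable => n; apply: sub_sigma_algebra.
      by exists (\col_k (if k == i then a else - n%:R)).
    rewrite ord1; apply/seteqP; split => [x /=|x [n _ /= /(_ i)]]; last first.
      by rewrite mxE eqxx in_itv/= andbT.
    rewrite in_itv/= andbT => ax.
    have : [set: 'cV[R]_p] x by [].
    rewrite -coverG => -[n _ nx]; exists n => // k; rewrite mxE.
    by case: eqP => [->//|_]; have := nx k; rewrite mxE.
  by have := mx measurableT B mB; rewrite setTI.
move=> A mA; apply: (measure_unique G (fun i => orth (const_mx (- i%:R)))) => //.
- apply/seteqP; split=> //; apply: smallest_sub; first exact: sigma_algebra_measurable.
  by move=> _ [b _ <-]; exact: measurable_orthant.
- move=> _ _ [b _ <-] [c _ <-]; exists (\col_k Num.max (b k 0) (c k 0)) => //.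
  apply/seteqP; split => [x bcx|x [bx cx] k]; last first.
    by rewrite mxE gt_max bx cx.
  by split => k; have := bcx k; rewrite mxE gt_max => /andP[].
- by move=> i; exists (const_mx (- i%:R)).
- by move=> _ [b _ <-]; exact: m12.
- move=> k; apply: le_lt_trans m1oo; apply: le_measure; rewrite ?inE//.
  exact: measurable_orthant.
Qed.

End borel_matrices.

(** * Integrability of bounded random variables *)

Section bounded_expectation.
Context d (T : measurableType d) (R : realType) (P : probability T R).

Lemma integrable_bounded (f : T -> R) (M : R) : measurable_fun setT f ->
  (forall t, `|f t| <= M) -> P.-integrable setT (EFin \o f).
Proof.
move=> mf fM; apply: measurable_bounded_integrable => //.
  by apply: fin_num_fun_lty => //; exact: fin_num_measure.
by exists M; split => [|x Mx t _]; [exact: num_real|exact: le_trans (ltW Mx)].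
Qed.

Lemma integrable_bounded_comp d' (S : measurableType d') (X : T -> S)
    (f : S -> R) (M : R) :
  measurable_fun setT X -> measurable_fun setT f -> (forall s, `|f s| <= M) ->
  P.-integrable setT (fun t => (f (X t))%:E).
Proof.
move=> mX mf fM; apply: (@integrable_bounded (f \o X) M).
  exact: measurableT_comp.
by move=> t; exact: fM.
Qed.

End bounded_expectation.

Section trigonometric_measurability.
Context {R : realType}.

Lemma measurable_cos : measurable_fun setT (@cos R).
Proof. by apply: continuous_measurable_fun; exact: continuous_cos. Qed.

Lemma measurable_sin : measurable_fun setT (@sin R).
Proof. by apply: continuous_measurable_fun; exact: continuous_sin. Qed.

End trigonometric_measurability.

(** * A law on column vectors is determined by its characteristic function *)

Section characteristic_function_uniqueness.
Context {R : realType} {p : nat}.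

(** Only linear combinations are built in, so equality of expectations passes to [trig_poly] by
    linearity alone; stability under products is derived in [trig_mul]. *)
Inductive trig_poly : ('cV[R]_p -> R) -> Prop :=
| trig_cos u : trig_poly (fun x => cos (dotv u x))
| trig_sin u : trig_poly (fun x => sin (dotv u x))
| trig_add f g : trig_poly f -> trig_poly g -> trig_poly (fun x => f x + g x)
| trig_scale c f : trig_poly f -> trig_poly (fun x => c * f x).

Lemma dotvDl (u v x : 'cV[R]_p) : dotv (u + v) x = dotv u x + dotv v x.
Proof. by rewrite /dotv linearD/= mulmxDl mxE. Qed.

Lemma dotvNl (u x : 'cV[R]_p) : dotv (- u) x = - dotv u x.
Proof. by rewrite /dotv linearN/= mulNmx mxE. Qed.

Lemma dotvZl c (u x : 'cV[R]_p) : dotv (c *: u) x = c * dotv u x.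
Proof. by rewrite /dotv linearZ/= -scalemxAl mxE. Qed.

Lemma dotv0l (x : 'cV[R]_p) : dotv 0 x = 0.
Proof. by rewrite /dotv trmx0 mul0mx mxE. Qed.

Lemma dotvE (u x : 'cV[R]_p) : dotv u x = \sum_i u i 0 * x i 0.
Proof. by rewrite /dotv mxE; apply: eq_bigr => i _; rewrite mxE. Qed.

Lemma dotv_delta k (x : 'cV[R]_p) : dotv (delta_mx k 0) x = x k 0.
Proof.
rewrite dotvE (bigD1 k)//= big1 ?addr0 => [|i ik]; rewrite !mxE ?eqxx ?mul1r//.
by rewrite (negbTE ik) mul0r.
Qed.

Lemma trig_cst c : trig_poly (fun=> c).
Proof.
rewrite (_ : (fun=> c) = (fun x => c * cos (dotv 0 x))).
  exact/trig_scale/trig_cos.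
by apply/funext => x; rewrite dotv0l cos0 mulr1.
Qed.

(** Product-to-sum formulas settle the products of sines and cosines; bilinearity does the rest, by
    induction on both factors. *)
Lemma trig_mul f g : trig_poly f -> trig_poly g -> trig_poly (fun x => f x * g x).
Proof.
move=> tf; elim: tf g => [u|u|f1 f2 _ IH1 _ IH2|c f1 _ IH1] g tg.
- elim: tg => [v|v|g1 g2 _ IH1 _ IH2|c g1 _ IH1].
  + rewrite (_ : (fun x => cos (dotv u x) * cos (dotv v x)) = fun x =>
       2^-1 * cos (dotv (u + v) x) + 2^-1 * cos (dotv (u - v) x)).
      by apply: trig_add; exact/trig_scale/trig_cos.
    by apply/funext => x; rewrite !dotvDl dotvNl cosB cosD; field.
  + rewrite (_ : (fun x => cos (dotv u x) * sin (dotv v x)) = fun x =>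
       2^-1 * sin (dotv (u + v) x) + (- 2^-1) * sin (dotv (u - v) x)).
      by apply: trig_add; exact/trig_scale/trig_sin.
    by apply/funext => x; rewrite !dotvDl dotvNl sinB sinD; field.
  + under eq_fun do rewrite mulrDr.
    exact: trig_add.
  + under eq_fun do rewrite mulrCA.
    exact: trig_scale.
- elim: tg => [v|v|g1 g2 _ IH1 _ IH2|c g1 _ IH1].
  + rewrite (_ : (fun x => sin (dotv u x) * cos (dotv v x)) = fun x =>
       2^-1 * sin (dotv (u + v) x) + 2^-1 * sin (dotv (u - v) x)).
      by apply: trig_add; exact/trig_scale/trig_sin.
    by apply/funext => x; rewrite !dotvDl dotvNl sinB sinD; field.
  + rewrite (_ : (fun x => sin (dotv u x) * sin (dotv v x)) = fun x =>
       (- 2^-1) * cos (dotv (u + v) x) + 2^-1 * cos (dotv (u - v) x)).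
      by apply: trig_add; exact/trig_scale/trig_cos.
    by apply/funext => x; rewrite !dotvDl dotvNl cosB cosD; field.
  + under eq_fun do rewrite mulrDr.
    exact: trig_add.
  + under eq_fun do rewrite mulrCA.
    exact: trig_scale.
- under eq_fun do rewrite mulrDl.
  by apply: trig_add; [exact: IH1|exact: IH2].
- under eq_fun do rewrite -mulrA.
  by apply: trig_scale; exact: IH1.
Qed.

Lemma trig_prod (I : finType) (f : I -> 'cV[R]_p -> R) :
  (forall i, trig_poly (f i)) -> trig_poly (fun x => \prod_i f i x).
Proof.
move=> tf; elim: (index_enum I) => [|i s IH].
  under eq_fun do rewrite big_nil.
  exact: trig_cst.
under eq_fun do rewrite big_cons.
exact: trig_mul.
Qed.

(* [cubic] fixes -1, 0 and 1 and its iterates converge on [-1, 1] to the sign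
   function. *)
Let cubic (s : R) : R := 3 / 2 * s + (- 2^-1) * (s * (s * s)).

Lemma trig_iter_cubic f n :
  trig_poly f -> trig_poly (fun x => iter n cubic (f x)).
Proof.
move=> tf; elim: n => [//|n IH]; rewrite /= {1}/cubic.
apply: trig_add; apply: trig_scale => //.
by apply: trig_mul => //; exact: trig_mul.
Qed.

Let cubicN s : cubic (- s) = - cubic s.
Proof. rewrite /cubic; ring. Qed.

Let iter_cubicN n s : iter n cubic (- s) = - iter n cubic s.
Proof. by elim: n => //= n ->; rewrite cubicN. Qed.

(** The identity [1 - cubic s = (1 - s) * ((1 - s) * (2 + s) / 2)] shows a contraction towards 1:
    the second factor is [1 - s / 2 - s ^+ 2 / 2], at most [1 - a / 2]. *)
Let cubic_itv (a s : R) : 0 <= a -> a <= s <= 1 ->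
  a <= cubic s <= 1 /\ 1 - cubic s <= (1 - a / 2) * (1 - s).
Proof.
move=> a0 /andP[las s1]; have s0 : 0 <= s by exact: le_trans las.
have cs : cubic s - s = 2^-1 * (s * ((1 - s) * (1 + s))) by rewrite /cubic; field.
have c1 : 1 - cubic s = 2^-1 * ((1 - s) ^+ 2 * (2 + s)) by rewrite /cubic; field.
split; first (apply/andP; split).
- rewrite (le_trans las)// -subr_ge0 cs !mulr_ge0//; lra.
- rewrite -subr_ge0 c1 !mulr_ge0 ?sqr_ge0//; lra.
rewrite c1 -subr_ge0 (_ : _ - _ = 2^-1 * ((1 - s) * ((s - a) + s ^+ 2))); last by field.
rewrite mulr_ge0// mulr_ge0 ?subr_ge0// addr_ge0 ?sqr_ge0 ?subr_ge0//.
Qed.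

(** The iterates never fall below the starting point, which therefore serves as [a] in [cubic_itv]
    at every step and gives one geometric rate. *)
Let iter_cubic_gt0 (s : R) n : 0 <= s <= 1 ->
  s <= iter n cubic s <= 1 /\ 1 - iter n cubic s <= (1 - s / 2) ^+ n.
Proof.
move=> /andP[s0 s1]; elim: n => [|n [IH1 IH2]] /=.
  by rewrite lexx s1 expr0 gerBl.
have [-> h] := cubic_itv s0 IH1; split=> //.
rewrite exprS (le_trans h)// ler_wpM2l//; nra.
Qed.

Let iter_cubic_norm s n : `|s| <= 1 -> `|iter n cubic s| <= 1.
Proof.
move=> s1; have [s0|s0] := leP 0 s.
  have [|/andP[h1 h2] _] := @iter_cubic_gt0 s n.
    by rewrite s0 (le_trans (ler_norm _) s1).
  by rewrite ger0_norm// (le_trans s0).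
have [|/andP[h1 h2] _] := @iter_cubic_gt0 (- s) n.
  by rewrite oppr_ge0 ltW// (le_trans (ler_norm _))// normrN.
rewrite -normrN -iter_cubicN ger0_norm// (le_trans _ h1)//.
by rewrite oppr_ge0 ltW.
Qed.

(** For positive [s] the geometric rate squeezes the iterates to 1; oddness of [cubic] gives the
    negative case, and 0 is fixed. *)
Let iter_cubic_cvg s : `|s| <= 1 -> iter n cubic s @[n --> \oo] --> Num.sg s.
Proof.
have pos r : 0 < r <= 1 -> iter n cubic r @[n --> \oo] --> (1 : R).
  move=> /andP[r0 r1].
  have h : (fun n => 1 - (1 - r / 2) ^+ n) @ \oo --> (1 : R).
    rewrite -[X in _ --> X]subr0; apply: cvgB; first exact: cvg_cst.
    by apply: cvg_expr; rewrite ger0_norm; lra.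
  apply: (squeeze_cvgr _ h (cvg_cst (1 : R))).
  near=> n; have [|/andP[_ ->] ?] := @iter_cubic_gt0 r n.
    by rewrite r1 ltW.
  by rewrite andbT lerBlDl -lerBlDr.
rewrite ler_norml => /andP[s1 s2]; case: (ltgtP s 0) => [s0|s0|->].
- rewrite ltr0_sg// -[s]opprK; under eq_fun do rewrite iter_cubicN.
  by apply: cvgN; apply: pos; rewrite oppr_gt0 s0 lerNl.
- by rewrite gtr0_sg//; apply: pos; rewrite s0.
- rewrite sgr0 (_ : (fun n => iter n cubic 0) = fun=> 0); first exact: cvg_cst.
  by apply/funext; elim=> //= n ->; rewrite /cubic !mulr0 addr0.
Unshelve. all: by end_near. Qed.

(** The quadratic sending -1, 0, 1 to 0, 0, 1: it turns a sign into the indicator of strict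
    positivity, and keeps [trig_poly] stable. *)
Let half_sgn (r : R) : R := 2^-1 * (r ^+ 2 + r).

Let half_sgn_norm r : `|r| <= 1 -> `|half_sgn r| <= 1.
Proof.
rewrite !ler_norml /half_sgn => /andP[r1 r2].
have -> : 2^-1 * (r ^+ 2 + r) = 1 - 2^-1 * ((1 - r) * (2 + r)) by field.
have : 0 <= (1 - r) * (2 + r) by rewrite mulr_ge0//; lra.
have : 0 <= (1 + r) ^+ 2 by exact: sqr_ge0.
nra.
Qed.

Let half_sgn_cvg (u : R^nat) (l : R) : u @ \oo --> l -> half_sgn (u n) @[n --> \oo] --> half_sgn l.
Proof.
move=> ul; apply: cvgM; first exact: cvg_cst.
by apply: cvgD => //; rewrite expr2; under eq_fun do rewrite expr2; exact: cvgM.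
Qed.

Let half_sgn_sg (r : R) : half_sgn (Num.sg r) = (0 < r)%R%:R.
Proof.
rewrite /half_sgn; case: sgrP => _; rewrite ?expr0n ?addr0 ?mulr0//.
  by rewrite expr1n mulVf.
by rewrite sqrrN expr1n subrr mulr0.
Qed.

Lemma cvg_prod_fin (I : finType) (u : I -> R^nat) (l : I -> R) :
  (forall i, u i @ \oo --> l i) -> \prod_i u i n @[n --> \oo] --> \prod_i l i.
Proof.
move=> ul; elim: (index_enum I) => [|i s IH].
  rewrite big_nil; under eq_fun do rewrite big_nil.
  exact: cvg_cst.
rewrite big_cons; under eq_fun do rewrite big_cons.
exact: cvgM.
Qed.

Lemma prod_norm_le1 (I : finType) (u : I -> R) :
  (forall i, `|u i| <= 1) -> `|\prod_i u i| <= 1.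
Proof.
move=> u1; have := @ler_prod R I (index_enum I) xpredT (Num.norm \o u) (fun=> 1).
by rewrite big1_eq normr_prod; apply => i _; rewrite normr_ge0 u1.
Qed.

Context d (T : measurableType d) (P : probability T R).
Context d' (T' : measurableType d') (P' : probability T' R).
Variables (X : T -> 'cV[R]_p) (Y : T' -> 'cV[R]_p).
Hypotheses (mX : measurable_fun setT X) (mY : measurable_fun setT Y).

(** The bound is carried along because it makes the expectations finite, as additivity requires. *)
Let agree (f : 'cV[R]_p -> R) :=
  [/\ measurable_fun setT f, exists M : R, forall x, `|f x| <= M &
      (\int[P]_t (f (X t))%:E = \int[P']_t (f (Y t))%:E)%E].

Let agree_add f g : agree f -> agree g -> agree (fun x => f x + g x).
Proof.
move=> [mf [M fM] fXY] [mg [N gN] gXY]; split.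
- exact: measurable_funD.
- exists (M + N) => x; exact: (le_trans (ler_normD _ _) (lerD _ _)).
- under eq_integral do rewrite EFinD.
  under [RHS]eq_integral do rewrite EFinD.
  by rewrite !integralD ?fXY ?gXY//;
    exact: integrable_bounded_comp fM || exact: integrable_bounded_comp gN.
Qed.

Let agree_scale c f : agree f -> agree (fun x => c * f x).
Proof.
move=> [mf [M fM] fXY]; split.
- exact: measurable_funM.
- by exists (`|c| * M) => x; rewrite normrM ler_wpM2l.
- under eq_integral do rewrite EFinM.
  under [RHS]eq_integral do rewrite EFinM.
  by rewrite !integralZl ?fXY//; exact: integrable_bounded_comp fM.
Qed.

(** Dominated convergence on both probability spaces, the constant 1 being the majorant. *)
Let agree_lim (f_ : nat -> 'cV[R]_p -> R) (f : 'cV[R]_p -> R) : (forall n, agree (f_ n)) ->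
  (forall n x, `|f_ n x| <= 1) -> (forall x, f_ n x @[n --> \oo] --> f x) ->
  agree f.
Proof.
move=> af f1 ff.
have mf_ n : measurable_fun setT (f_ n) by have [] := af n.
have mf : measurable_fun setT f.
  by apply: (measurable_fun_cvg mf_) => x _; exact: ff.
have lim_int dZ (Z : measurableType dZ) (Q : probability Z R) (V : Z -> 'cV[R]_p) :
    measurable_fun setT V ->
    (\int[Q]_t (f_ n (V t))%:E @[n --> \oo] --> \int[Q]_t (f (V t))%:E)%E.
  move=> mV.
  have [] := @dominated_convergence _ _ R Q setT measurableT
    (fun n t => (f_ n (V t))%:E) (fun t => (f (V t))%:E) (cst 1%E).
  - by move=> n; apply/measurable_EFinP; exact: measurableT_comp.
  - by apply/measurable_EFinP; exact: measurableT_comp.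
  - by apply: aeW => t _; apply: cvg_EFin; [exact: nearW|exact: ff].
  - apply: (@integrable_bounded _ _ _ Q (fun=> 1) 1) => // t.
    by rewrite normr1.
  - by apply: aeW => t n _; rewrite lee_fin.
  - by move=> _ _.
split=> //.
  by exists 1 => x; apply: (cvgr_to_le (cvg_norm (ff x))); exact: nearW.
rewrite -(cvg_lim _ (lim_int _ _ P X mX))// -(cvg_lim _ (lim_int _ _ P' Y mY))//.
by congr (limn _); apply/funext => n; have [] := af n.
Qed.

Let agree_trig f :
  (forall u, \int[P]_t (cos (dotv u (X t)))%:E = \int[P']_t (cos (dotv u (Y t)))%:E)%E ->
  (forall u, \int[P]_t (sin (dotv u (X t)))%:E = \int[P']_t (sin (dotv u (Y t)))%:E)%E ->
  trig_poly f -> agree f.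
Proof.
move=> cosXY sinXY; elim=> [u|u|f1 f2 _ af1 _ af2|c f1 _ af1].
- split; [|by exists 1 => x; exact: cos_max|exact: cosXY].
  exact: (measurableT_comp measurable_cos (measurable_dotvr u)).
- split; [|by exists 1 => x; exact: sin_max|exact: sinXY].
  exact: (measurableT_comp measurable_sin (measurable_dotvr u)).
- exact: agree_add.
- exact: agree_scale.
Qed.

(** Once [n] exceeds [|z|], the argument lies in []-2, 2[], where the sine has the sign of its
    argument. *)
Let sin_div_sg (z : R) : \forall n \near \oo, (0 < sin (z / n.+1%:R)) = (0 < z).
Proof.
near=> n; have n0 : 0 < n.+1%:R :> R by [].
have zn : `|z / n.+1%:R| < 2.
  rewrite normrM normfV [X in _ / X]ger0_norm// ltr_pdivrMr//.
  apply: (@lt_le_trans _ _ n%:R).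
    by near: n; exact: nbhs_infty_gtr.
  by rewrite -natrM ler_nat (leq_trans (leqnSn n))// leq_pmull.
rewrite -[in RHS](@pmulr_lgt0 _ n.+1%:R^-1) ?invr_gt0//.
move: zn; rewrite ltr_norml => /andP[zn1 zn2].
case: (ltgtP (z / n.+1%:R) 0) => [z0|z0|->]; last by rewrite sin0 ltxx.
- apply/negbTE; rewrite -leNgt -[_ / _]opprK sinN oppr_le0 ltW//.
  by apply: sin2_gt0; rewrite oppr_gt0 z0 ltrNl.
- by apply: sin2_gt0; rewrite z0.
Unshelve. all: by end_near. Qed.

Lemma char_fun_inj : (0 < p)%N ->
  (forall u, \int[P]_t (cos (dotv u (X t)))%:E = \int[P']_t (cos (dotv u (Y t)))%:E)%E ->
  (forall u, \int[P]_t (sin (dotv u (X t)))%:E = \int[P']_t (sin (dotv u (Y t)))%:E)%E ->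
  forall A, measurable A -> P (X @^-1` A) = P' (Y @^-1` A).
Proof.
move=> p0 cosXY sinXY.
pose s n (b : 'cV[R]_p) k (x : 'cV[R]_p) := sin ((x k 0 - b k 0) / n.+1%:R).
(* The subtraction formula moves the shift [b] into the coefficients. *)
have ts n b k : trig_poly (s n b k).
  rewrite (_ : s n b k = fun x =>
    cos (b k 0 / n.+1%:R) * sin (dotv (n.+1%:R^-1 *: delta_mx k 0) x) +
    - sin (b k 0 / n.+1%:R) * cos (dotv (n.+1%:R^-1 *: delta_mx k 0) x)).
    by apply: trig_add; apply: trig_scale; [exact: trig_sin|exact: trig_cos].
  apply/funext => x; rewrite /s dotvZl dotv_delta mulrBl sinB mulNr.
  by rewrite [_^-1 * x k 0]mulrC; ring.
have s1 n b k x : `|s n b k x| <= 1 by exact: sin_max.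
(* Inner limit, at fixed [n]: the cubic iterates turn each sine into its sign, and [half_sgn] turns
   the sign into 0 or 1. *)
have a1 n b : agree (fun x => \prod_k (0 < s n b k x)%R%:R).
  apply: (@agree_lim (fun m x => \prod_k half_sgn (iter m cubic (s n b k x)))).
  - move=> m; apply: agree_trig => //; apply: trig_prod => k.
    apply: trig_scale; apply: trig_add; last exact: trig_iter_cubic.
    by under eq_fun do rewrite expr2; apply: trig_mul; exact: trig_iter_cubic.
  - by move=> m x; apply: prod_norm_le1 => k; exact/half_sgn_norm/iter_cubic_norm.
  - move=> x; apply: cvg_prod_fin => k; rewrite -half_sgn_sg.
    exact/half_sgn_cvg/iter_cubic_cvg.
(* Outer limit: at each [x] the factors are eventually constant in [n], by [sin_div_sg]. *)
have a2 (b : 'cV[R]_p) : agree (fun x => \1_[set x : 'cV[R]_p | forall k, b k 0 < x k 0] x).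
  apply: (agree_lim (a1 ^~ b)).
  - move=> n x; apply: prod_norm_le1 => k.
    by case: (_ < _); rewrite ?normr1 ?normr0 ?lexx ?ler01.
  - move=> x; have -> : \1_[set x : 'cV[R]_p | forall k, b k 0 < x k 0] x =
        \prod_k (b k 0 < x k 0)%R%:R :> R.
      rewrite indicE; have [/[!inE] /= bx|] := boolP (_ \in _).
        by rewrite big1// => k _; rewrite bx.
      rewrite notin_setE => /existsNP[k kx]; rewrite (bigD1 k)//=.
      by case: (ltP (b k 0)) kx => // _ _; rewrite mul0r.
    apply: cvg_prod_fin => k; apply: cvg_near_cst.
    near=> n; rewrite /s -[in RHS]subr_gt0; congr (nat_of_bool _)%:R.
    by near: n; exact: sin_div_sg.
apply: (@eq_measure_orthants _ _ (pushforward P X) (pushforward P' Y)) => //.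
  rewrite /= /pushforward preimage_setT.
  by apply: fin_num_fun_lty => //; exact: fin_num_measure.
have int_indic dZ (Z : measurableType dZ) (Q : probability Z R) (V : Z -> 'cV[R]_p)
    (A : set 'cV[R]_p) : measurable_fun setT V -> measurable A ->
    (\int[Q]_t (\1_A (V t))%:E = Q (V @^-1` A))%E.
  move=> mV mA; rewrite -[RHS]/(Q _) -[V @^-1` A]setIT -integral_indic//.
  by rewrite -[_ @^-1` _]setTI; exact: mV.
move=> b; have [_ _] := a2 b.
by rewrite !int_indic//; exact: measurable_orthant.
Unshelve. all: by end_near. Qed.

End characteristic_function_uniqueness.

(** * Expectations of functions of independent variables *)

Section independence.
Context d (T : measurableType d) (R : realType) (P : probability T R).
Context d1 (T1 : measurableType d1).

(** Independence says that the law of the pair and the product of the laws agree on rectangles,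
    hence everywhere; Tonelli's theorem then separates the two integrals. *)
Lemma integral_independent2 d2 (T2 : measurableType d2) (X : T -> T1) (Y : T -> T2)
    (f : T1 * T2 -> R) :
  measurable_fun setT X -> measurable_fun setT Y -> independent2 P X Y ->
  measurable_fun setT f -> (forall z, 0 <= f z) ->
  (\int[P]_t (f (X t, Y t))%:E = \int[P]_t \int[P]_t' (f (X t, Y t'))%:E)%E.
Proof.
move=> mX mY XY mf f0.
pose X' : {RV P >-> T1} := HB.pack X (isMeasurableFun.Build _ _ _ _ _ mX).
pose Y' : {RV P >-> T2} := HB.pack Y (isMeasurableFun.Build _ _ _ _ _ mY).
have mXY : measurable_fun setT (fun t => (X t, Y t)).
  exact: measurable_fun_pair.
pose XY' : {RV P >-> (T1 * T2)%type} :=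
  HB.pack (fun t => (X t, Y t)) (isMeasurableFun.Build _ _ _ _ _ mXY).
have mEf : measurable_fun setT (EFin \o f) by exact/measurable_EFinP.
transitivity (\int[distribution P XY']_z (f z)%:E)%E.
  by rewrite ge0_integral_distribution// => z; rewrite lee_fin.
transitivity (\int[distribution P X' \x distribution P Y']_z (f z)%:E)%E.
  apply: eq_measure_integral => A mA _; apply/esym.
  apply: (@product_measure_unique _ _ _ _ R (distribution P X')
    (distribution P Y') (distribution P XY')) => //.
rewrite fubini_tonelli1//=.
rewrite ge0_integral_distribution//=; last 2 first.
- exact: measurable_fun_fubini_tonelli_F.
- by move=> x; apply: integral_ge0 => y _; rewrite lee_fin.
apply: eq_integral => t _ /=; rewrite /fubini_F ge0_integral_distribution//=.
- by apply: (measurableT_comp mEf); exact: pair1_measurable.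
- by move=> y; rewrite lee_fin.
Qed.

Lemma integral_prod_mutually_independent (I : finType) (X : I -> T -> T1)
    (f : T1 -> R) (c : I -> R) :
  (forall i, measurable_fun setT (X i)) -> mutually_independent P X ->
  measurable_fun setT f -> (forall x, 0 <= f x) ->
  (forall i, \int[P]_t (f (X i t))%:E = (c i)%:E)%E ->
  (\int[P]_t (\prod_i f (X i t))%:E = (\prod_i c i)%:E)%E.
Proof.
move=> mX indX mf f0 intf.
pose D (J : {set I}) (A : I -> set T1) := \bigcap_(j in [set` J]) (X j @^-1` A j).
have c0 i : 0 <= c i.
  by rewrite -lee_fin -intf; apply: integral_ge0 => t _; rewrite lee_fin.
have mprod (r : seq I) : measurable_fun setT (fun t => \prod_(i <- r) f (X i t)).
  by apply: measurable_prod => i _; exact: (measurableT_comp mf (mX i)).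
have prod0 (r : seq I) t : 0 <= \prod_(i <- r) f (X i t) by exact: prodr_ge0.
have mD J A : (forall i, measurable (A i)) -> measurable (D J A).
  move=> mA; apply: fin_bigcap_measurable => // i _.
  by rewrite -[_ @^-1` _]setTI; exact: mX.
(* Indicators are replaced by [f] one index at a time. *)
have main (r : seq I) : uniq r -> forall (J : {set I}) (A : I -> set T1),
    (forall i, i \in r -> i \notin J) -> (forall i, measurable (A i)) ->
    (\int[P]_(t in D J A) (\prod_(i <- r) f (X i t))%:E =
     (\prod_(i <- r) c i)%:E * P (D J A))%E.
  elim: r => [_ J A _ mA|i r IH /= /andP[ir ur] J A rJ mA].
    under eq_integral do rewrite big_nil.
    rewrite big_nil mul1e integral_cst ?mul1e//.
    exact: mD.
  have mDJ := mD J A mA.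
  pose g1 t := \1_(D J A) t * \prod_(j <- r) f (X j t).
  pose k := \prod_(j <- r) c j * fine (P (D J A)).
  transitivity (\int[P]_t (f (X i t) * g1 t)%:E)%E.
    rewrite integral_mkcond; apply: eq_integral => t _.
    rewrite patchE /g1 indicE big_cons.
    by case: ifPn => _ /=; rewrite ?mul1r// mul0r mulr0.
  have k0 : 0 <= k by rewrite mulr_ge0 ?prodr_ge0// fine_ge0.
  rewrite (@eq_integral_weighted _ _ _ T T T1 R P P (X i) (X i) g1 (fun=> k))//.
  - under eq_integral do rewrite mulrC EFinM.
    rewrite ge0_integralZl ?lee_fin//; last 2 first.
    + by apply/measurable_EFinP; exact: (measurableT_comp mf (mX i)).
    + by move=> t _; rewrite lee_fin.
    rewrite intf big_cons /k.
    rewrite -[P (D J A)]fineK ?fin_num_measure// -!EFinM; congr EFin.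
    by rewrite /=; ring.
  - by apply: measurable_funM => //; exact: measurable_indic.
  - by move=> t; rewrite mulr_ge0// indicE.
  move=> B mB.
  have mXB : measurable (X i @^-1` B).
    by rewrite -[_ @^-1` _]setTI; exact: mX.
  rewrite integral_cst//.
  (* The event on [X i] joins the family indexed by [J], which brings back the shape of the
     induction hypothesis with [i |: J]. *)
  pose A' j := if j == i then B else A j.
  have iJ : i \notin J by apply: rJ; rewrite mem_head.
  have DA' : D (i |: J) A' = X i @^-1` B `&` D J A.
    apply/seteqP; split => [t Dt|t [Bt Dt] j].
      split; first by have := Dt i; rewrite /A' eqxx /= !inE eqxx; exact.
      move=> j /= jJ; have := Dt j; rewrite /A' /= !inE jJ orbT => /(_ isT).
      by case: eqP jJ iJ => // ->  ->.
    rewrite /= !inE /A'; case: eqP => [-> //|_ /= jJ]; exact: Dt.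
  have mA' j : measurable (A' j) by rewrite /A'; case: eqP.
  transitivity (\int[P]_(t in D (i |: J) A') (\prod_(j <- r) f (X j t))%:E)%E.
    rewrite DA' [LHS]integral_mkcond [RHS]integral_mkcond; apply: eq_integral => t _.
    rewrite !patchE in_setI /g1 indicE.
    by case: ifPn => _ //=; case: ifPn => _ /=; rewrite ?mul1r// mul0r.
  rewrite IH//; last first.
    move=> j jr; rewrite !inE negb_or rJ ?inE ?jr ?orbT// andbT.
    by apply: contraNneq ir => <-.
  rewrite /D !indX// big_setU1//= {1}/A' eqxx /k.
  under [X in (_ * (_ * X))%E]eq_bigr => j jJ.
    rewrite /A' (_ : (j == i) = false); last by apply: contraNF iJ => /eqP <-.
    over.
  rewrite -indX// -/(D J A) EFinM fineK ?fin_num_measure// muleCA muleA.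
  by rewrite -muleA muleC.
have := main (index_enum I) (index_enum_uniq I) finset.set0 (fun=> setT).
rewrite (_ : D _ _ = setT); last first.
  by rewrite /D -subTset => t _ j /=; rewrite inE.
by rewrite probability_setT mule1; apply => // i; rewrite inE.
Qed.

End independence.

(** * Scaling and integration of derivatives on the real line *)

Section lebesgue_real_line.
Context {R : realType}.
Notation mu := (@lebesgue_measure R).

(** The left-hand side is a measure in [A] that gives the intervals []a, b]] their length, and
    Lebesgue measure is the only one. *)
Lemma lebesgue_measure_scale (c : R) (A : set R) : 0 < c -> measurable A ->
  (c%:E * mu ( *%R c @^-1` A) = mu A)%E.
Proof.
move=> c0 mA; have c0' : 0 <= c by exact: ltW.
have mc : measurable_fun setT ( *%R c : R -> measurableTypeR R).
  exact: measurable_funM.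
pose m : {measure set (measurableTypeR R) -> \bar R} :=
  mscale (NngNum c0') (pushforward mu ( *%R c : R -> measurableTypeR R)).
apply/esym; rewrite -[RHS]/(m mc A); apply: lebesgue_measure_unique => //.
move=> _ [[a b] _ <-] /=.
rewrite -[RHS]/(c%:E * mu ( *%R c @^-1` `]a, b]%classic))%E.
have -> : *%R c @^-1` `]a, b]%classic = `]a / c, b / c]%classic.
  apply/seteqP; split => x /=; rewrite !in_itv/= ltr_pdivrMr// ler_pdivlMr//.
    by rewrite !(mulrC c).
  by rewrite !(mulrC c).
rewrite !lebesgue_measure_itv/= !lte_fin ltr_pM2r ?invr_gt0//.
case: ifPn => _; last by rewrite mule0.
by rewrite -!EFinB -EFinM; congr EFin; rewrite -mulrBl mulrC divfK// gt_eqF.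
Qed.

Lemma integral_scale (c : R) (f : R -> R) : 0 < c -> measurable_fun setT f ->
  (forall x, 0 <= f x) ->
  (\int[mu]_x (f (c * x) * c)%:E = \int[mu]_x (f x)%:E)%E.
Proof.
move=> c0 mf f0; under [RHS]eq_integral do rewrite -[X in X%:E]mulr1.
apply: (@eq_integral_weighted _ _ _ _ _ R R mu mu ( *%R c) id (fun=> c) (fun=> 1)) => //.
  by move=> _; exact: ltW.
move=> A mA; have mcA : measurable ( *%R c @^-1` A).
  rewrite -[_ @^-1` _]setTI.
  exact: (measurable_funM (measurable_cst c) (@measurable_id _ _ setT)).
by rewrite !integral_cst// mul1e lebesgue_measure_scale.
Qed.

(** The fundamental theorem of calculus applies on [[- n, n]]; dominated convergence, with majorant
    [|f|], lets [n] grow. *)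
Lemma integral_derive_eq0 (F f : R -> R) :
  (forall x : R, is_derive x (1 : R) F (f x)) -> continuous f ->
  mu.-integrable setT (EFin \o f) ->
  F n%:R @[n --> \oo] --> (0 : R) -> F (- n%:R) @[n --> \oo] --> (0 : R) ->
  (\int[mu]_x (f x)%:E = 0)%E.
Proof.
move=> dF cf intf Fy FNy.
have mf : measurable_fun setT f by exact: continuous_measurable_fun.
have cF : continuous F.
  move=> x; apply/differentiable_continuous/derivable1_diffP.
  by case: (dF x).
pose f_ (n : nat) x := (f x * \1_`[- n%:R, n%:R]%classic x)%:E.
have int_f_ n : (0 < n)%N -> (\int[mu]_x f_ n x = (F n%:R - F (- n%:R))%R%:E)%E.
  move=> n0; have nn : - n%:R < n%:R :> R by rewrite gtrN// ltr0n.
  transitivity (\int[mu]_(x in `[(- n%:R)%R, n%:R%R]) (f x)%:E)%E.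
    rewrite [RHS]integral_mkcond; apply: eq_integral => x _.
    by rewrite patchE /f_ indicE; case: ifPn => _; rewrite ?mulr1 ?mulr0.
  rewrite (@continuous_FTC2 R f F _ _ nn) ?EFinB//.
  - exact: continuous_subspaceT.
  - split; [by move=> x _; case: (dF x)| |].
    + by apply: cvg_at_right_filter; exact: cF.
    + by apply: cvg_at_left_filter; exact: cF.
  - by move=> x _; rewrite derive1E; case: (dF x).
have [] := @dominated_convergence _ _ R mu setT measurableT f_ (EFin \o f)
  (abse \o (EFin \o f)).
- move=> n; apply/measurable_EFinP; apply: measurable_funM => //.
- by apply/measurable_EFinP.
- apply: aeW => x _; apply: cvg_near_cst.
  near=> n; rewrite /f_ indicE mem_set ?mulr1//= in_itv/=.
  have : `|x| <= n%:R by near: n; exact: nbhs_infty_ger.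
  by rewrite ler_norml.
- exact: integrable_abse.
- apply: aeW => x n _; rewrite /f_ lee_fin normrM.
  by rewrite ler_piMr// indicE; case: (_ \in _); rewrite /= ?normr1 ?normr0.
move=> _ _ /= lim_f; have : (\int[mu]_x f_ n x @[n --> \oo] --> 0)%E.
  have : (F n%:R - F (- n%:R))%:E @[n --> \oo] --> (0%:E : \bar R).
    apply: cvg_EFin; first exact: nearW.
    by rewrite -[X in _ --> X](subrr (0 : R)); exact: cvgB.
  apply: cvg_trans; apply: near_eq_cvg; near=> n.
  by rewrite int_f_//; near: n; exact: nbhs_infty_gt.
by move=> /(cvg_unique _ lim_f) => /(_ (@ereal_hausdorff R)).
Unshelve. all: by end_near. Qed.

End lebesgue_real_line.

(** * The characteristic function of a centered normal density *)

Section normal_characteristic_function.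
Context {R : realType}.
Notation mu := (@lebesgue_measure R).

Lemma normal_pdf0E (s x : R) : s != 0 ->
  normal_pdf 0 s x = normal_peak s * expR (- (x ^+ 2 / (s ^+ 2 *+ 2))).
Proof. by move=> s0; rewrite normal_pdfE// /normal_fun subr0 mulNr. Qed.

Variables (s : R) (s0 : 0 < s).
Let p := normal_pdf (0 : R) s.

Let s_neq0 : s != 0. Proof. by rewrite gt_eqF. Qed.

Let is_derive_p (x : R) : is_derive x (1 : R) p (- (x / s ^+ 2) * p x).
Proof.
rewrite (_ : p = fun x => normal_peak s * expR (- (x ^+ 2 / (s ^+ 2 *+ 2)))); last first.
  by apply/funext => y; rewrite /p normal_pdf0E.
apply: trigger_derive; rewrite /GRing.scale/=.
by field.
Qed.

Let cont_p : continuous p. Proof. exact: continuous_normal_pdf. Qed.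

Let mp : measurable_fun setT p. Proof. exact: measurable_normal_pdf. Qed.

Let p_ge0 x : 0 <= p x. Proof. exact: normal_pdf_ge0. Qed.

(** Doubling the standard deviation leaves a Gaussian factor that absorbs [|x|], and the right-hand
    side is an integrable majorant. *)
Let xp_bound : exists2 C : R, 0 <= C & forall x, `|x| * p x <= C * normal_pdf 0 (2 * s) x.
Proof.
(* With [y] the difference of the two exponents, [|x| <= K * expR y] is needed. Since
   [expR y >= 1 + y], this [K] suffices: [K * (1 + y)] contains [1 + x ^+ 2], which is at least
   [|x|]. *)
pose K := 1 + 8 * s ^+ 2 / 3.
have s20 : 0 < s ^+ 2 by rewrite exprn_gt0.
have K0 : 0 < K by rewrite /K addr_gt0// divr_gt0// mulr_gt0.
exists (K * normal_peak s / normal_peak (2 * s)) => [|x].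
  by rewrite !mulr_ge0 ?invr_ge0 ?normal_peak_ge0// ltW.
have s2_neq0 : 2 * s != 0 by rewrite mulf_neq0.
have peak0 : normal_peak (2 * s) != 0 by rewrite gt_eqF// normal_peak_gt0.
rewrite /p !normal_pdf0E// [leRHS]mulrA divfK//.
rewrite mulrCA [leRHS]mulrAC [leRHS]mulrC.
rewrite ler_wpM2l ?normal_peak_ge0//.
set y := 3 * x ^+ 2 / (8 * s ^+ 2).
have -> : - (x ^+ 2 / (s ^+ 2 *+ 2)) = - (x ^+ 2 / ((2 * s) ^+ 2 *+ 2)) - y.
  by rewrite /y; field.
rewrite expRD mulrCA mulrC ler_wpM2r ?expR_ge0//.
rewrite expRN ler_pdivrMr ?expR_gt0//.
have : K * (1 + y) <= K * expR y by rewrite ler_wpM2l ?expR_ge1Dx// ltW.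
apply: le_trans.
have -> : K * (1 + y) = 1 + y + 8 * s ^+ 2 / 3 + x ^+ 2 by rewrite /K /y; field.
have y0 : 0 <= y by rewrite /y divr_ge0// mulr_ge0// sqr_ge0.
have z0 : 0 <= 8 * s ^+ 2 / 3 by rewrite divr_ge0// mulr_ge0// sqr_ge0.
rewrite -[x ^+ 2]real_normK ?num_real//.
have := sqr_ge0 (`|x| - 1); nra.
Qed.

Lemma integrable_bounded_normal_pdf (f : R -> R) : measurable_fun setT f ->
  (forall x, `|f x| <= 1) -> mu.-integrable setT (fun x => (f x * normal_pdf 0 s x)%:E).
Proof.
move=> mf f1; apply: (le_integrable measurableT _ _ (integrable_normal_pdf 0 s)).
  by apply/measurable_EFinP; exact: measurable_funM.
move=> x _; rewrite lee_fin normrM ler_piMl//.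
Qed.

Let integrable_xp_bounded (f : R -> R) : measurable_fun setT f ->
  (forall x, `|f x| <= 1) -> mu.-integrable setT (fun x => (x * f x * p x)%:E).
Proof.
move=> mf f1; have [C C0 xp] := xp_bound.
have := integrableZl measurableT C (integrable_normal_pdf 0 (2 * s)).
apply: le_integrable => //.
  apply/measurable_EFinP; apply: measurable_funM => //.
  exact: measurable_funM.
move=> x _; rewrite /= lee_fin mulrAC normrM.
apply: (@le_trans _ _ (`|x| * p x)).
  by rewrite normrM [`|p x|]ger0_norm// ler_piMr// mulr_ge0.
apply: (le_trans (xp x)); rewrite ger0_norm// mulr_ge0//.
exact: normal_pdf_ge0.
Qed.

Let phi (t : R) := (\int[mu]_x (cos (t * x) * p x))%R.

Let measurable_cosM (t : R) : measurable_fun setT (fun x : R => cos (t * x)).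
Proof. by apply: (measurableT_comp measurable_cos); exact: measurable_funM. Qed.

Let measurable_sinM (t : R) : measurable_fun setT (fun x : R => sin (t * x)).
Proof. by apply: (measurableT_comp measurable_sin); exact: measurable_funM. Qed.

Let is_derive_mull (t x : R) : is_derive x (1 : R) (fun y : R => t * y) t.
Proof.
have := is_deriveZ t (is_derive_id x (1 : R)).
by rewrite /GRing.scale /= mulr1.
Qed.

Let is_derive_sinM (t x : R) :
  is_derive x (1 : R) (fun y : R => sin (t * y)) (cos (t * x) * t).
Proof. exact: (is_derive1_comp (is_derive_sin _) (is_derive_mull t x)). Qed.

Let is_derive_cosM (t x : R) :
  is_derive x (1 : R) (fun y : R => cos (t * y)) (- sin (t * x) * t).
Proof. exact: (is_derive1_comp (is_derive_cos _) (is_derive_mull t x)). Qed.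

Let xsin_sin (t : R) :
  (\int[mu]_x (x * sin (t * x) * p x) = t * s ^+ 2 * phi t)%R.
Proof.
(* Stein's identity: integrate the derivative of [sin (t x) p x], knowing that
   [p' x = - x / s^2 p x]. *)
pose F (x : R) := sin (t * x) * p x.
pose f (x : R) := t * cos (t * x) * p x - x * sin (t * x) * p x / s ^+ 2.
have dF x : is_derive x (1 : R) F (f x).
  apply: is_derive_eq (is_deriveM (is_derive_sinM t x) (is_derive_p x)) _.
  by rewrite /GRing.scale/= /f; field.
have pN x : p (- x) = p x by rewrite /p !normal_pdf0E// sqrrN.
(* As [n <= n ^ 2], the density at [n] is below a geometric sequence. *)
have p_cvg0 : p n%:R @[n --> \oo] --> (0 : R).
  have geo : normal_peak s * expR (- (s ^+ 2 *+ 2)^-1) ^+ n @[n --> \oo] --> (0 : R).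
    rewrite -[X in _ --> X](mulr0 (normal_peak s)); apply: cvgM; first exact: cvg_cst.
    apply: cvg_expr; rewrite ger0_norm ?expR_ge0// expR_lt1 oppr_lt0 invr_gt0.
    by rewrite mulrn_wgt0// exprn_gt0.
  apply: (squeeze_cvgr _ (cvg_cst (0 : R)) geo); apply: nearW => n.
  rewrite p_ge0/= /p normal_pdf0E// ler_wpM2l ?normal_peak_ge0//.
  rewrite -expRM_natl ler_expR mulrN lerN2 ler_wpM2r ?invr_ge0 ?mulrn_wge0 ?sqr_ge0//.
  by rewrite -natrX ler_nat; case: n => // n; rewrite -mulnn leq_pmulr.
have F_cvg0 (u : R^nat) : (forall n, p (u n) = p n%:R) -> F (u n) @[n --> \oo] --> (0 : R).
  move=> pu; apply: norm_cvg0; apply: (squeeze_cvgr _ (cvg_cst (0 : R)) p_cvg0).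
  apply: nearW => n; rewrite normr_ge0/= /F normrM pu [`|p _|]ger0_norm//.
  by rewrite ler_piMl// sin_max.
have int1 : mu.-integrable setT (EFin \o (fun x => t * (cos (t * x) * p x))).
  apply: (@integrableZl _ _ _ mu _ measurableT t (fun x => (cos (t * x) * p x)%:E)).
  by apply: integrable_bounded_normal_pdf => // x; exact: cos_max.
have int2 : mu.-integrable setT (EFin \o (fun x => (s ^+ 2)^-1 * (x * sin (t * x) * p x))).
  apply: (@integrableZl _ _ _ mu _ measurableT _ (fun x => (x * sin (t * x) * p x)%:E)).
  by apply: integrable_xp_bounded => // x; exact: sin_max.
have fE : f = (fun x => t * (cos (t * x) * p x) - (s ^+ 2)^-1 * (x * sin (t * x) * p x)).
  by apply/funext => x; rewrite /f mulrA [(s ^+ 2)^-1 * _]mulrC.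
have intf : mu.-integrable setT (EFin \o f).
  by rewrite fE; exact: (integrableB measurableT int1 int2).
have cf : continuous f.
  have cont_der (h h' : R -> R) : (forall x, is_derive x (1 : R) h (h' x)) -> continuous h.
    move=> dh x; apply/differentiable_continuous/derivable1_diffP.
    by case: (dh x).
  have cc := cont_der _ _ (is_derive_cosM t); have cs := cont_der _ _ (is_derive_sinM t).
  move=> x; apply: cvgB.
    by apply: cvgM; [apply: cvgM; [exact: cvg_cst|exact: cc]|exact: cont_p].
  apply: cvgM; last exact: cvg_cst.
  by apply: cvgM; [apply: cvgM; [exact: cvg_id|exact: cs]|exact: cont_p].
have := @integral_derive_eq0 R F f dF cf intf (F_cvg0 _ (fun=> erefl)) (F_cvg0 _ (fun=> pN _)).
move=> /(congr1 fine) /=; rewrite -/(Rintegral mu setT f) fE RintegralB//.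
rewrite !RintegralZl//; last 2 first.
- by apply: integrable_xp_bounded => // x; exact: sin_max.
- by apply: integrable_bounded_normal_pdf => // x; exact: cos_max.
move=> /eqP; rewrite subr_eq0 => /eqP; rewrite -/(phi t) => h.
by rewrite mulrAC h mulrC mulVKf// expf_neq0.
Qed.

(** Differentiation under the integral, dominated by [|x| * p x], produces the integral that
    [xsin_sin] evaluates. *)
Let is_derive_phi (t : R) : is_derive t (1 : R) phi (- (t * s ^+ 2) * phi t).
Proof.
pose f (t x : R) := cos (t * x) * p x.
pose G (x : R) := `|x| * p x.
have dfE t' x : is_derive t' (1 : R) (f ^~ x) (- (x * sin (t' * x) * p x)).
  have dc : is_derive t' (1 : R) (fun u => cos (x * u)) (- sin (x * t') * x).
    exact: is_derive_cosM.
  have := is_deriveZ (p x) dc; rewrite /GRing.scale/=.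
  rewrite (_ : _ \*: _ = f ^~ x); last first.
    by apply/funext => u; rewrite /f /= /GRing.scale/= mulrC [x * u]mulrC.
  by move=> h; apply: is_derive_eq h _; rewrite [x * t']mulrC; ring.
have d1E t' x : partial1of2 f t' x = - (x * sin (t' * x) * p x).
  by rewrite partial1of2E; case: (dfE t' x).
(* The radius 1 is arbitrary, the majorant [G] being independent of [t']. *)
have It : `]t - 1, t + 1[%classic t by rewrite /= in_itv/= ltrDl ltrBlDr ltrDl ltr01.
have intf t' : `]t - 1, t + 1[%classic t' -> mu.-integrable setT (EFin \o f t').
  by move=> _; apply: integrable_bounded_normal_pdf => // x; exact: cos_max.
have derf t' x : `]t - 1, t + 1[%classic t' -> setT x -> derivable (f ^~ x) t' 1.
  by move=> _ _; case: (dfE t' x).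
have G0 x : 0 <= G x by rewrite /G mulr_ge0.
have intG : mu.-integrable setT (EFin \o G).
  have [C C0 xp] := xp_bound.
  have := integrableZl measurableT C (integrable_normal_pdf 0 (2 * s)).
  apply: le_integrable => //.
    by apply/measurable_EFinP; apply: measurable_funM => //; exact: measurableT_comp.
  move=> x _; rewrite /= lee_fin ger0_norm// (le_trans (xp x))// ger0_norm// mulr_ge0//.
  exact: normal_pdf_ge0.
have Gub t' x : `]t - 1, t + 1[%classic t' -> setT x -> `|partial1of2 f t' x| <= G x.
  move=> _ _; rewrite d1E normrN normrM [`|p x|]ger0_norm// /G ler_wpM2r//.
  by rewrite normrM ler_piMr// sin_max.
have dphi := derivable_under_integral measurableT It intf derf G0 intG Gub.
have phi'E := differentiation_under_integral measurableT It intf derf G0 intG Gub.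
apply: DeriveDef; first exact: dphi.
rewrite -derive1E [LHS]phi'E.
rewrite (_ : - (t * s ^+ 2) * phi t = - (t * s ^+ 2 * phi t)) ?mulNr// -xsin_sin.
under eq_Rintegral do rewrite /= d1E -mulN1r.
rewrite RintegralZl ?mulN1r//.
by apply: integrable_xp_bounded => // x; exact: sin_max.
Qed.

(** By [is_derive_phi], the product of [phi] and [expR (t ^+ 2 * s ^+ 2 / 2)] has derivative zero,
    and its value at 0 is the total mass 1. *)
Lemma integral_cos_normal (t : R) :
  (\int[mu]_x (cos (t * x) * normal_pdf 0 s x))%R = expR (- (t ^+ 2 * s ^+ 2 / 2)).
Proof.
pose g (t : R) := phi t * expR (t ^+ 2 * s ^+ 2 / 2).
have : g t = g 0.
  apply: is_derive_0_is_cst => x; have dphi := is_derive_phi x.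
  rewrite /g; apply: trigger_derive; rewrite /GRing.scale/=.
  by field.
rewrite /g expr0n/= !mul0r expR0 mulr1.
have -> : phi 0 = 1.
  rewrite /phi; under eq_Rintegral do rewrite mul0r cos0 mul1r.
  by rewrite /Rintegral integral_normal_pdf.
move=> h; apply: (mulIf (lt0r_neq0 (expR_gt0 (t ^+ 2 * s ^+ 2 / 2)))).
by rewrite -expRD addNr expR0.
Qed.

End normal_characteristic_function.

Lemma measurable_sqrt (R : realType) : measurable_fun setT (@Num.sqrt R).
Proof. by apply: continuous_measurable_fun; exact: sqrt_continuous. Qed.

(** * Expectations under normal and Gamma laws *)

Section integrals_against_laws.
Context {R : realType} d (T : measurableType d) (P : probability T R).
Notation mu := (@lebesgue_measure R).

(** With [m] and [Y] general, one statement covers Lebesgue densities, the Dirac mass and comparison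
    with another random variable. *)
Lemma integral_same_law d1 (T1 : measurableType d1) (Y : T1 -> R)
    (m : {measure set T1 -> \bar R}) (X : T -> R) (g : T1 -> R) (f : R -> R) :
  measurable_fun setT X -> measurable_fun setT Y -> measurable_fun setT g ->
  (forall t, 0 <= g t) ->
  (forall A, measurable A -> P (X @^-1` A) = \int[m]_(x in Y @^-1` A) (g x)%:E)%E ->
  measurable_fun setT f -> (forall x, 0 <= f x) ->
  (\int[P]_t (f (X t))%:E = \int[m]_x (f (Y x) * g x)%:E)%E.
Proof.
move=> mX mY mg g0 lawX mf f0.
under [in LHS]eq_integral do rewrite -[f _]mulr1.
apply: (@eq_integral_weighted _ _ _ _ _ _ _ _ _ X Y (fun=> 1) g) => // A mA.
rewrite integral_cst ?mul1e; first exact: lawX.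
by rewrite -[_ @^-1` _]setTI; exact: mX.
Qed.

(** Removes the summand 1 that keeps integrands nonnegative; boundedness makes the cancellation
    legitimate in the extended reals. *)
Lemma integral_1D (f : T -> R) (c : R) : measurable_fun setT f ->
  (forall t, `|f t| <= 1) -> (\int[P]_t (1 + f t)%:E = (1 + c)%:E)%E ->
  (\int[P]_t (f t)%:E = c%:E)%E.
Proof.
move=> mf f1; under eq_integral do rewrite EFinD.
have intf := integrable_bounded P mf f1.
rewrite integralD//; last first.
  by apply: (@integrable_bounded _ _ _ P (fun=> 1) 1) => // t; rewrite normr1.
have -> : (\int[P]_x 1 = 1)%E by rewrite integral_cst// mul1e; exact: probability_setT.
rewrite -[(\int[P]_x (f x)%:E)%E]fineK; last exact: integrable_fin_num.
by rewrite -EFinD => -[] /addrI ->.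
Qed.

Section centered_normal.
Variables (X : T -> R) (v : R).
Hypotheses (mX : measurable_fun setT X) (v_ge0 : 0 <= v).
Hypothesis lawX : forall A, measurable A -> P (X @^-1` A) = centered_normal v A.

Lemma integral_centered_normal0 (f : R -> R) : v = 0 ->
  measurable_fun setT f -> (forall x, 0 <= f x) ->
  (\int[P]_t (f (X t))%:E = (f 0)%:E)%E.
Proof.
move=> v0 mf f0.
rewrite (@integral_same_law _ _ id (dirac (0 : R)) X (fun=> 1) f)//.
  rewrite integral_dirac//=; last first.
    by apply/measurable_EFinP; exact: measurable_funM.
  by rewrite diracT mul1e mulr1.
move=> A mA; rewrite lawX// /centered_normal v0 eqxx.
by rewrite integral_cst// mul1e.
Qed.

Lemma integral_centered_normal (f : R -> R) : 0 < v ->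
  measurable_fun setT f -> (forall x, 0 <= f x) ->
  (\int[P]_t (f (X t))%:E = \int[mu]_x (f x * normal_pdf 0 (Num.sqrt v) x)%:E)%E.
Proof.
move=> v0 mf f0.
apply: (@integral_same_law _ (measurableTypeR R) id mu X (normal_pdf 0 (Num.sqrt v)) f) => //.
- exact: measurable_normal_pdf.
- by move=> x; exact: normal_pdf_ge0.
by move=> A mA; rewrite lawX// /centered_normal gt_eqF.
Qed.

(* The summand [1] makes the integrands nonnegative, as the change of law and
   Tonelli's theorem require. *)
Lemma integral_1Dcos_centered_normal :
  (\int[P]_t (1 + cos (X t))%:E = (1 + expR (- (v / 2)))%:E)%E.
Proof.
have m1cos : measurable_fun setT (fun x : R => 1 + cos x).
  by apply: measurable_funD => //; exact: measurable_cos.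
have cos0 (x : R) : 0 <= 1 + cos x by rewrite -lerBlDl sub0r cos_geN1.
have [v0|v0] := eqVneq v 0.
  rewrite (@integral_centered_normal0 (fun x => 1 + cos x))//.
  by rewrite trigo.cos0 v0 mul0r oppr0 expR0.
have {}v0 : 0 < v by rewrite lt0r v0.
have s0 : 0 < Num.sqrt v by rewrite sqrtr_gt0.
rewrite (@integral_centered_normal (fun x => 1 + cos x))//.
have intcos : mu.-integrable setT (fun x => (cos (1 * x) * normal_pdf 0 (Num.sqrt v) x)%:E).
  apply: integrable_bounded_normal_pdf => // [|x]; last exact: cos_max.
  by apply: (measurableT_comp measurable_cos); exact: measurable_funM.
have := integral_cos_normal s0 1.
under eq_integral do rewrite mulrDl mul1r EFinD.
rewrite integralD//; last 2 first.
- exact: integrable_normal_pdf.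
- by under eq_fun do rewrite -[X in cos X]mul1r.
rewrite integral_normal_pdf => h; rewrite EFinD; congr (_ + _)%E.
under eq_integral do rewrite -[X in cos X]mul1r.
rewrite -[LHS]fineK; last exact: integrable_fin_num.
by rewrite -/(Rintegral _ _ _) h expr1n mul1r sqr_sqrtr.
Qed.

(** The value is [(1 + a v)^(-1/2)], in exponential form so that a power of it only multiplies the
    exponent. *)
Lemma integral_expR_sqr_centered_normal (a : R) : 0 <= a ->
  (\int[P]_t (expR (- (a / 2 * X t ^+ 2)))%:E =
   (expR (- (2^-1 * ln (1 + a * v))))%:E)%E.
Proof.
move=> a0.
have mexp : measurable_fun setT (fun x : R => expR (- (a / 2 * x ^+ 2))).
  apply: (measurableT_comp (@measurable_expR R)); apply: measurableT_comp => //.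
  by apply: measurable_funM => //; exact: measurable_funX.
have [v0|v0] := eqVneq v 0.
  rewrite (@integral_centered_normal0 (fun x => expR (- (a / 2 * x ^+ 2))))//.
  by rewrite v0 expr0n/= !mulr0 addr0 ln1 mulr0.
have {}v0 : 0 < v by rewrite lt0r v0.
rewrite (@integral_centered_normal (fun x => expR (- (a / 2 * x ^+ 2))))//.
have k0 : 0 < 1 + a * v by rewrite ltr_pwDl// mulr_ge0// ltW.
(* Since [1 / w = 1 / v + a], the integrand is the normal density of variance [w] up to the constant
   [c], the ratio of the two peaks. *)
pose w := v / (1 + a * v); have w0 : 0 < w by rewrite divr_gt0.
have sv0 : Num.sqrt v != 0 by rewrite gt_eqF// sqrtr_gt0.
have sw0 : Num.sqrt w != 0 by rewrite gt_eqF// sqrtr_gt0.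
have v_neq0 : v != 0 by rewrite gt_eqF.
have k_neq0 : 1 + a * v != 0 by rewrite gt_eqF.
pose c := expR (- (2^-1 * ln (1 + a * v))).
have peak_vw : normal_peak (Num.sqrt v) = c * normal_peak (Num.sqrt w).
  have -> : c = (Num.sqrt (1 + a * v))^-1.
    rewrite /c expRN -powR12_sqrt; last exact: ltW.
    by rewrite /powR (negbTE k_neq0).
  rewrite /normal_peak -invfM -sqrtrM ?ltW//; congr (Num.sqrt _)^-1.
  by rewrite !sqr_sqrtr ?ltW// /w; field.
transitivity (\int[mu]_x (c%:E * (normal_pdf 0 (Num.sqrt w) x)%:E))%E.
  apply: eq_integral => x _; rewrite -EFinM !normal_pdf0E//; congr EFin.
  rewrite peak_vw mulrCA -!mulrA; congr (_ * (_ * _)).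
  rewrite -expRD !sqr_sqrtr ?ltW//; congr expR; rewrite /w.
  by field; rewrite k_neq0 v_neq0.
rewrite integralZl//; last exact: integrable_normal_pdf.
by rewrite integral_normal_pdf mule1.
Qed.

End centered_normal.

(** Multiplying the Gamma density by [expR (- (c * x))] rescales it by [1 + c], up to the constant
    [(1 + c)^(-a)]. *)
Lemma integral_expR_gamma (a c : R) (U : T -> R) : 0 <= c ->
  gamma_distributed P a 1 U ->
  (\int[P]_t (expR (- (c * Num.sqrt (U t) ^+ 2)))%:E =
   (expR (- (a * ln (1 + c))))%:E)%E.
Proof.
move=> c0 [mU lawU].
pose q := @gamma_pdf R a 1.
have mq : measurable_fun setT q.
  rewrite (_ : q = fun x => 1 `^ a / Gamma_fun a * x `^ (a - 1) * expR (- (1 * x)) *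
      \1_`]0, +oo[%classic x).
    apply: measurable_funM => //; apply: measurable_funM; last first.
      apply: (measurableT_comp (@measurable_expR R)).
      by apply: measurableT_comp => //; exact: measurable_funM.
    by apply: measurable_funM => //; exact: measurable_powR.
  apply/funext => x; rewrite /q /gamma_pdf indicE mem_setE in_itv/= andbT.
  by case: ifPn => _; rewrite ?mulr1 ?mulr0.
have q0 x : 0 <= q x.
  rewrite /q /gamma_pdf; case: ifPn => // _.
  rewrite !mulr_ge0 ?invr_ge0 ?powR_ge0 ?expR_ge0//.
  by apply: Rintegral_ge0 => y _; rewrite mulr_ge0 ?powR_ge0 ?expR_ge0.
(* The value of [Gamma_fun a] is never needed: the normalisation is read off
   the law of [U]. *)
have intq : (\int[mu]_x (q x)%:E = 1)%E.
  by rewrite -[LHS]lawU// preimage_setT probability_setT.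
rewrite (@integral_same_law _ (measurableTypeR R) id mu U q
  (fun x => expR (- (c * Num.sqrt x ^+ 2))))//; last first.
  apply: (measurableT_comp (@measurable_expR R)); apply: measurableT_comp => //.
  by apply: measurable_funM => //; apply: measurable_funX; exact: measurable_sqrt.
have k0 : 0 < 1 + c by rewrite ltr_pwDl.
pose K := expR (- (a * ln (1 + c))).
transitivity (\int[mu]_x (K%:E * (q ((1 + c) * x) * (1 + c))%:E))%E.
  apply: eq_integral => x _; rewrite -EFinM; congr EFin.
  (* For [x <= 0] both densities vanish; for [x > 0] the squared root is [x] itself. *)
  rewrite /q /gamma_pdf pmulr_rgt0//; case: ifPn => x0; last by rewrite mul0r !mulr0.
  rewrite sqr_sqrtr ?ltW// !mul1r.
  rewrite powRM ?ltW//.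
  have -> : expR (- ((1 + c) * x)) = expR (- (c * x)) * expR (- x).
    by rewrite -expRD; congr expR; ring.
  have KE : K * ((1 + c) `^ (a - 1) * (1 + c)) = 1.
    have lnk : 1 + c = expR (ln (1 + c)) by rewrite lnK.
    rewrite /K /powR gt_eqF// [X in _ * (_ * X)]lnk -!expRD (_ : _ + _ = 0) ?expR0//.
    by ring.
  rewrite -[LHS]mul1r -[X in X * _]KE; ring.
rewrite ge0_integralZl//.
- by rewrite (integral_scale k0)// intq mule1.
- apply/measurable_EFinP; apply: measurable_funM => //.
  by apply: measurableT_comp => //; exact: measurable_funM.
- by move=> x _; rewrite lee_fin mulr_ge0// ltW.
- by rewrite lee_fin expR_ge0.
Qed.

End integrals_against_laws.

(** * Algebra and measurability of quadratic forms *)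

Section quadratic_forms.
Context {R : realType} {n : nat}.
Implicit Types (S : 'M[R]_n) (u v : 'cV[R]_n).

Lemma quadformN S u : quadform S (- u) = quadform S u.
Proof. by rewrite /quadform [(- u)^T]linearN/= !mulNmx mulmxN opprK. Qed.

Lemma quadformZ S c u : quadform S (c *: u) = c ^+ 2 * quadform S u.
Proof.
by rewrite /quadform [(c *: u)^T]linearZ/= -!scalemxAl -scalemxAr scalerA mxE expr2.
Qed.

Lemma quadformZl S c u : quadform (c *: S) u = c * quadform S u.
Proof. by rewrite /quadform -scalemxAr -scalemxAl mxE. Qed.

Lemma quadform_scalar c u : quadform c%:M u = \sum_j c * u j 0 ^+ 2.
Proof.
rewrite /quadform mul_mx_scalar -scalemxAl mxE -mulr_sumr; congr (_ * _).
by rewrite mxE; apply: eq_bigr => j _; rewrite mxE expr2.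
Qed.

Lemma measurable_quadform d (T : measurableType d) S (f : T -> 'cV[R]_n) :
  measurable_fun setT f -> measurable_fun setT (fun t => quadform S (f t)).
Proof.
move=> mf; rewrite (_ : (fun t => _) = fun t => dotv (S^T *m f t) (f t)).
  by apply: measurable_dotv => //; exact: measurable_mulmx.
by apply/funext => t; rewrite /quadform /dotv trmx_mul trmxK.
Qed.

End quadratic_forms.

(** * Gaussian vectors, evaluated at fixed and at random directions *)

Section gaussian_integrals.
Context {R : realType} d (T : measurableType d) (P : probability T R).
Context (n : nat) (S : 'M[R]_n) (X : T -> 'cV[R]_n).
Hypotheses (gX : gaussian P S X) (S_ge0 : forall u, 0 <= quadform S u).

Let mX : measurable_fun setT X. Proof. by case: gX. Qed.

Let mdX u : measurable_fun setT (fun t => dotv u (X t)).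
Proof. exact: (measurableT_comp (measurable_dotvr u) mX). Qed.

Let m1sin : measurable_fun setT (fun x : R => 1 + sin x).
Proof. by apply: measurable_funD => //; exact: measurable_sin. Qed.

Let m1cos : measurable_fun setT (fun x : R => 1 + cos x).
Proof. by apply: measurable_funD => //; exact: measurable_cos. Qed.

Let sin1_ge0 (x : R) : 0 <= 1 + sin x.
Proof. by rewrite -lerBlDl sub0r sin_geN1. Qed.

Let cos1_ge0 (x : R) : 0 <= 1 + cos x.
Proof. by rewrite -lerBlDl sub0r cos_geN1. Qed.

Let int1 : (\int[P]_t 1 = 1)%E.
Proof. by rewrite integral_cst// mul1e; exact: probability_setT. Qed.

Lemma integral_1Dcos_gaussian u :
  (\int[P]_t (1 + cos (dotv u (X t)))%:E = (1 + expR (- (quadform S u / 2)))%:E)%E.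
Proof.
by apply: integral_1Dcos_centered_normal => // A mA; case: gX => _; exact.
Qed.

(** The quadratic form is even, so [u] and [- u] give the same law and the expected sine equals its
    opposite. *)
Lemma integral_1Dsin_gaussian u : (\int[P]_t (1 + sin (dotv u (X t)))%:E = 1)%E.
Proof.
have intsin w : P.-integrable setT (fun t => (sin (dotv w (X t)))%:E).
  exact: (integrable_bounded_comp P (mdX w) measurable_sin (@sin_max R)).
have sym : (\int[P]_t (1 + sin (dotv u (X t)))%:E =
            \int[P]_t (1 + sin (dotv (- u) (X t)))%:E)%E.
  rewrite (@integral_same_law _ _ _ P _ T (fun t => dotv (- u) (X t)) P
    (fun t => dotv u (X t)) (fun=> 1) (fun x => 1 + sin x))//.
    by apply: eq_integral => t _; rewrite mulr1.
  move=> A mA; rewrite integral_cst ?mul1e; last first.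
    by rewrite -[_ @^-1` _]setTI; exact: mdX.
  case: gX => _ law; rewrite [LHS](law u)// -quadformN.
  exact/esym/(law (- u)).
have D w : (\int[P]_t (1 + sin (dotv w (X t)))%:E =
             1 + \int[P]_t (sin (dotv w (X t)))%:E)%E.
  under eq_integral do rewrite EFinD.
  rewrite integralD ?int1//.
  by apply: (@integrable_bounded _ _ _ P (fun=> 1) 1) => // t; rewrite normr1.
move: sym; rewrite !D.
under [in RHS]eq_integral do rewrite dotvNl sinN EFinN.
rewrite integralN/=; last first.
  exact/integrable_add_def.
rewrite -[(\int[P]_x (sin (dotv u (X x)))%:E)%E]fineK; last exact: integrable_fin_num.
rewrite -!EFinN -!EFinD => -[] /addrI h; congr EFin.
by move: h; set I := fine _; lra.
Qed.

Context d1 (T1 : measurableType d1) (A : T -> T1) (a : T1 -> 'cV[R]_n).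
Hypotheses (mA : measurable_fun setT A) (ma : measurable_fun setT a).
Hypothesis AX : independent2 P A X.

Let mdot : measurable_fun setT (fun z : T1 * 'cV[R]_n => dotv (a z.1) z.2).
Proof.
apply: measurable_dotv => //.
by apply: measurableT_comp => //.
Qed.

(** Independence freezes the random direction [a (A t)] while the Gaussian vector is integrated. The
    variable [A] will be the matrix [W], then the Gamma variable. *)
Lemma integral_cos_gaussian_mixture (c : R) :
  (\int[P]_t (expR (- (quadform S (a (A t)) / 2)))%:E = c%:E)%E ->
  (\int[P]_t (cos (dotv (a (A t)) (X t)))%:E = c%:E)%E.
Proof.
move=> intc; apply: integral_1D.
- apply: (measurableT_comp measurable_cos).
  by apply: measurable_dotv => //; exact: measurableT_comp.
- by move=> t; exact: cos_max.
rewrite (@integral_independent2 _ _ _ _ _ _ _ _ A X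
  (fun z => 1 + cos (dotv (a z.1) z.2)))//=; last first.
  exact: (measurableT_comp m1cos mdot).
under eq_integral do rewrite integral_1Dcos_gaussian EFinD.
rewrite ge0_integralD//.
- by rewrite int1 intc EFinD.
- apply/measurable_EFinP; apply: (measurableT_comp (@measurable_expR R)).
  apply: measurableT_comp => //; apply: measurable_funM => //.
  by apply: measurable_quadform; exact: measurableT_comp.
Qed.

Lemma integral_sin_gaussian_mixture :
  (\int[P]_t (sin (dotv (a (A t)) (X t)))%:E = 0)%E.
Proof.
apply: integral_1D.
- apply: (measurableT_comp measurable_sin).
  by apply: measurable_dotv => //; exact: measurableT_comp.
- by move=> t; exact: sin_max.
rewrite (@integral_independent2 _ _ _ _ _ _ _ _ A X
  (fun z => 1 + sin (dotv (a z.1) z.2)))//=; last first.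
  exact: (measurableT_comp m1sin mdot).
by under eq_integral do rewrite integral_1Dsin_gaussian; rewrite int1 addr0.
Qed.

End gaussian_integrals.

(** * Complex powers and characteristic functions through real quantities *)

Section complex_values.
Context {R : realType}.
Local Open Scope complex_scope.

(** A positive real has principal argument [acos 1], which is 0. *)
Lemma cpow_real (r a : R) : 0 < r -> cpow r%:C a = (expR (a * ln r))%:C.
Proof.
move=> r0; rewrite /cpow /clog /carg.
have -> : ComplexField.Normc.normc r%:C = r.
  by rewrite /ComplexField.Normc.normc /= expr0n addr0 sqrtr_sqr gtr0_norm.
rewrite /= lexx divff ?gt_eqF// acos1 /cexp /= !mul0r mulr0 subr0 addr0.
by rewrite cos0 sin0 mulr1 mulr0.
Qed.

Lemma char_funE d (T : measurableType d) (P : probability T R) p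
    (Z : T -> 'cV[R]_p) u (a b : R) :
  (\int[P]_t (cos (dotv u (Z t)))%:E = a%:E)%E ->
  (\int[P]_t (sin (dotv u (Z t)))%:E = b%:E)%E ->
  char_fun P Z u = a +i* b.
Proof.
move=> cosZ sinZ; rewrite /char_fun /Cexpectation /=; congr (_ +i* _).
  by rewrite unlock; under eq_integral do rewrite expR0 mul1r; rewrite cosZ.
by rewrite unlock; under eq_integral do rewrite expR0 mul1r; rewrite sinZ.
Qed.

End complex_values.

(** * The characteristic functions of [W y] and of [sqrt u x] *)

Section product_of_gaussians.
Context {R : realType} (p d : nat) (Sigma : 'M[R]_p) (alpha : R).
Hypotheses (Sigma_psd : psdmx Sigma) (alpha_ge0 : 0 <= alpha).

(** The common characteristic function [(1 + alpha u^T Sigma u)^(- d / 2)], which is real. *)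
Let phi (u : 'cV[R]_p) := expR (- (d%:R / 2 * ln (1 + alpha * quadform Sigma u))).

Let q_ge0 u : 0 <= quadform Sigma u. Proof. by case: Sigma_psd. Qed.

Section matrix_times_vector.
Context (dT : measure_display) (T : measurableType dT) (P : probability T R).
Variables (W : T -> 'M[R]_(p, d)) (y : T -> 'cV[R]_d).
Hypotheses (mW : measurable_fun setT W).
Hypothesis Wind : mutually_independent P (fun (j : 'I_d) t => col j (W t)).
Hypothesis Wcol : forall j : 'I_d, gaussian P Sigma (fun t => col j (W t)).
Hypotheses (yg : gaussian P alpha%:M y) (Wy : independent2 P W y).

Let a (u : 'cV[R]_p) (M : 'M[R]_(p, d)) : 'cV[R]_d := M^T *m u.

Let ma u : measurable_fun setT (a u).
Proof.
apply: measurable_mulmx => //; apply: measurable_fun_mx => i j.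
by under eq_fun do rewrite mxE; exact: measurable_mx_coord.
Qed.

Let aE u t : dotv u (W t *m y t) = dotv (a u (W t)) (y t).
Proof. by rewrite /dotv /a trmx_mul trmxK mulmxA. Qed.

Let alpha_psd (v : 'cV[R]_d) : 0 <= quadform alpha%:M v.
Proof.
by rewrite quadform_scalar sumr_ge0// => j _; rewrite mulr_ge0// sqr_ge0.
Qed.

Lemma integral_cos_gaussian_mulmx u :
  (\int[P]_t (cos (dotv u (W t *m y t)))%:E = (phi u)%:E)%E.
Proof.
under eq_integral do rewrite aE.
apply: (integral_cos_gaussian_mixture yg alpha_psd mW (ma u) Wy).
pose f (w : 'cV[R]_p) := expR (- (alpha / 2 * dotv u w ^+ 2)).
(* The coordinates of [W^T u] are the products of [u] with the columns, so the exponential of their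
   squared sum factors over independent columns. *)
transitivity (\int[P]_t (\prod_(j < d) f (col j (W t)))%:E)%E.
  apply: eq_integral => t _; congr EFin.
  rewrite quadform_scalar -expR_sum mulr_suml -sumrN; congr expR.
  apply: eq_bigr => j _; rewrite /a /f.
  have -> : ((W t)^T *m u) j 0 = dotv u (col j (W t)).
    by rewrite dotvE mxE; apply: eq_bigr => i _; rewrite !mxE mulrC.
  by ring.
rewrite (@integral_prod_mutually_independent _ _ _ P _ _ _ _ f
  (fun=> expR (- (2^-1 * ln (1 + alpha * quadform Sigma u)))))//.
- rewrite prodr_const card_ord -expRM_natl /phi; congr (expR _)%:E; ring.
- by move=> j; case: (Wcol j).
- apply: (measurableT_comp (@measurable_expR R)); apply: measurableT_comp => //.
  by apply: measurable_funM => //; apply: measurable_funX; exact: measurable_dotvr.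
- by move=> w; exact: expR_ge0.
move=> j; have [mWj lawj] := Wcol j.
apply: integral_expR_sqr_centered_normal => //.
  exact: (measurableT_comp (measurable_dotvr u) mWj).
exact: lawj.
Qed.

Lemma integral_sin_gaussian_mulmx u :
  (\int[P]_t (sin (dotv u (W t *m y t)))%:E = 0)%E.
Proof.
under eq_integral do rewrite aE.
exact: (integral_sin_gaussian_mixture yg mW (ma u) Wy).
Qed.

End matrix_times_vector.

Section scale_mixture.
Context (dT : measure_display) (T : measurableType dT) (P : probability T R).
Variables (U : T -> R) (x : T -> 'cV[R]_p).
Hypothesis Ugamma : gamma_distributed P (d%:R / 2) 1 U.
Hypotheses (xg : gaussian P ((2 * alpha) *: Sigma) x) (Ux : independent2 P U x).

Let a (u : 'cV[R]_p) (r : R) : 'cV[R]_p := Num.sqrt r *: u.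

Let mU : measurable_fun setT U. Proof. by case: Ugamma. Qed.

Let ma u : measurable_fun setT (a u).
Proof.
apply: measurable_fun_mx => i j; under eq_fun do rewrite mxE.
by apply: measurable_funM => //; exact: measurable_sqrt.
Qed.

Let aE u t : dotv u (Num.sqrt (U t) *: x t) = dotv (a u (U t)) (x t).
Proof. by rewrite /a dotvZl /dotv -scalemxAr mxE. Qed.

Let psd (v : 'cV[R]_p) : 0 <= quadform ((2 * alpha) *: Sigma) v.
Proof. by rewrite quadformZl !mulr_ge0. Qed.

Lemma integral_cos_gamma_gaussian u :
  (\int[P]_t (cos (dotv u (Num.sqrt (U t) *: x t)))%:E = (phi u)%:E)%E.
Proof.
under eq_integral do rewrite aE.
apply: (integral_cos_gaussian_mixture xg psd mU (ma u) Ux).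
(* The factor 2 in the covariance [2 alpha Sigma] cancels the half of the Gaussian exponent, which
   leaves this rate. *)
rewrite -(@integral_expR_gamma _ _ _ P _ (alpha * quadform Sigma u) _ _ Ugamma).
  apply: eq_integral => t _; rewrite quadformZl quadformZ; congr (expR _)%:E.
  by field.
by rewrite mulr_ge0.
Qed.

Lemma integral_sin_gamma_gaussian u :
  (\int[P]_t (sin (dotv u (Num.sqrt (U t) *: x t)))%:E = 0)%E.
Proof.
under eq_integral do rewrite aE.
exact: (integral_sin_gaussian_mixture xg mU (ma u) Ux).
Qed.

End scale_mixture.

End product_of_gaussians.

Theorem corollary6 (R : realType) (p d : nat) (hp : (0 < p)%N) (hd : (0 < d)%N)
    (Sigma : 'M[R]_p) (hSigma : psdmx Sigma) (alpha : R) (halpha : 0 <= alpha)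
    (dT : measure_display) (T : measurableType dT) (P : probability T R)
    (W : {RV P >-> 'M[R]_(p, d)}) (y : {RV P >-> 'cV[R]_d})
    (hWind : mutually_independent P (fun (j : 'I_d) (t : T) => col j (W t)))
    (hWcol : forall j : 'I_d, gaussian P Sigma (fun t => col j (W t)))
    (hy : gaussian P (alpha%:M) y)
    (hWy : independent2 P W y) :
  GAL P ((2 * alpha) *: Sigma) 0 (d%:R / 2) (fun t => W t *m y t) /\
  forall (dT' : measure_display) (T' : measurableType dT')
    (P' : probability T' R) (u : {RV P' >-> R}) (x : {RV P' >-> 'cV[R]_p}),
    gamma_distributed P' (d%:R / 2) 1 u ->
    gaussian P' ((2 * alpha) *: Sigma) x ->
    independent2 P' u x ->
    same_distribution P P' (fun t => W t *m y t)
      (fun t' => Num.sqrt (u t') *: x t').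
Proof.
have mW : measurable_fun setT W by exact: measurable_funPT.
have mWy : measurable_fun setT (fun t => W t *m y t).
  by apply: measurable_mulmx => //; exact: measurable_funPT.
have cosWy := integral_cos_gaussian_mulmx hSigma halpha mW hWind hWcol hy hWy.
have sinWy := integral_sin_gaussian_mulmx mW hy hWy.
split.
  split=> // u; rewrite (char_funE (cosWy u) (sinWy u)).
  have q0 : 0 <= quadform Sigma u by case: hSigma.
  have k0 : 0 < 1 + alpha * quadform Sigma u by rewrite ltr_pwDl// mulr_ge0.
  (* With zero mean the base is a positive real, so the principal power reduces to a real one. *)
  have -> : (1 / (1 + (quadform ((2 * alpha) *: Sigma) u / 2)%:C -
      (0 +i* dotv 0 u)) = (1 + alpha * quadform Sigma u)^-1%:C)%C.
    rewrite dotv0l subr0 quadformZl div1r fmorphV rmorphD /=.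
    by congr (_ + _%:C)^-1%C; field.
  by rewrite cpow_real ?invr_gt0// lnV ?posrE// mulrN.
move=> dT' T' P' u x ugam xg ux.
have mux : measurable_fun setT (fun t' => Num.sqrt (u t') *: x t').
  apply: measurable_fun_mx => i j; under eq_fun do rewrite mxE.
  apply: measurable_funM.
    exact: (measurableT_comp (@measurable_sqrt R) (measurable_funPT u)).
  exact: (measurableT_comp (measurable_mx_coord i j) (measurable_funPT x)).
(* The laws are compared through expectations only, so the two probability spaces may differ. *)
split => //; apply: (char_fun_inj mWy mux hp) => v.
- by rewrite cosWy (integral_cos_gamma_gaussian hSigma halpha ugam xg ux).
- by rewrite sinWy (integral_sin_gamma_gaussian ugam xg ux).
Qed.
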